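(* Let $U$ be a star-shaped open region of an $n$-dimensional Riemannian manifold, let $0\le k<n$, and let $\omega\in\Lambda^{k}(U)$ satisfy $\delta\omega=0$. Then there exists $\alpha\in\Lambda^{k+1}(U)$ such that $\omega=\delta\alpha$.
   Context: A star-shaped open region $U$ of a smooth manifold $M$ with $\dim M=n\ge 1$ is an open subset of $M$ diffeomorphic to an open ball in $\mathbb{R}^n$. $\Lambda^k(U)$ denotes the smooth differential $k$-forms on $U$. $U$ is oriented and carries a Riemannian metric $g$ (arbitrary, not necessarily flat), with Hodge star $\star:\Lambda^r(U)\to\Lambda^{n-r}(U)$, $\star\star\omega=(-1)^{r(n-r)}\omega$. $\eta$ is the grading automorphism, $\eta\omega=(-1)^p\omega$ for $\omega\in\Lambda^p(U)$. The codifferential is $\delta=\star^{-1}d\star\eta$, so $\delta\omega=(-1)^k\star^{-1}d\star\omega$ for $\omega\in\Lambda^k(U)$; it is zero on $0$-forms. *)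

(* Defs.v *)
(* MathComp / MathComp-Analysis; [R : realType] is the field of real numbers.
   Points and tangent vectors of R^n are row vectors ['rV[R]_n], and a k-tuple
   of tangent vectors is the matrix ['M[R]_(k, n)] of its rows. *)
From HB Require Import structures.
From mathcomp Require Import all_boot all_order all_algebra.
From mathcomp Require Import all_classical all_reals all_analysis.
Set Implicit Arguments.
Unset Strict Implicit.
Unset Printing Implicit Defensive.
Import Order.TTheory GRing.Theory Num.Theory.
Import numFieldNormedType.Exports.
Local Open Scope classical_set_scope.
Local Open Scope ring_scope.

(* [f] is of class C^m (resp. C^oo) at the points of [A]; meant for [A] open.
   A function is C^(m+1) iff it is differentiable and all its directional
   derivatives are C^m. *)
Fixpoint class_C (R : realType) (V W : normedModType R) (m : nat) (A : set V)
    (f : V -> W) : Prop :=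
  match m with
  | 0 => forall x, A x -> {for x, continuous f}
  | m'.+1 => (forall x, A x -> differentiable f x) /\
             (forall v : V, class_C m' A ('D_v f : V -> W))
  end.

Definition smooth_on (R : realType) (V W : normedModType R) (A : set V)
    (f : V -> W) : Prop := forall m, class_C m A f.

(* The norm of ['rV[R]_n] in the library is the sup norm, whose balls are
   cubes; this is the round ball. *)
Definition euclidean_ball (R : realType) (n : nat) (c : 'rV[R]_n) (r : R) :
    set 'rV[R]_n := [set x | \sum_j (x 0 j - c 0 j) ^+ 2 < r ^+ 2].

(* Smooth manifolds given by an atlas [cmap i : cdom i -> R^n];
   [cinv i] is the inverse of the chart [cmap i]. *)
Record manifold (R : realType) (n : nat) := Manifold {
  mpoint :> topologicalType ;
  manifold_hausdorff : hausdorff_space mpoint ;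
  manifold_second_countable : @second_countable mpoint ;
  chart : Type ;
  cdom : chart -> set mpoint ;
  cmap : chart -> mpoint -> 'rV[R]_n ;
  cinv : chart -> 'rV[R]_n -> mpoint ;
  open_cdom : forall i, open (cdom i) ;
  open_cmap : forall i, open (cmap i @` cdom i) ;
  cmapK : forall i p, cdom i p -> cinv i (cmap i p) = p ;
  cmap_continuous : forall i p, cdom i p -> {for p, continuous (cmap i)} ;
  cinv_continuous : forall i x, (cmap i @` cdom i) x ->
    {for x, continuous (cinv i)} ;
  cdom_cover : forall p, exists i, cdom i p ;
  transition_smooth : forall i j,
    smooth_on (cmap i @` (cdom i `&` cdom j)) (cmap j \o cinv i)
}.

Section OpenSubset.
Context (R : realType) (n : nat) (M : manifold R n) (U : set M).

Definition creg (i : chart M) : set 'rV[R]_n := cmap i @` (cdom i `&` U).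

Definition coverlap (i j : chart M) : set 'rV[R]_n :=
  cmap i @` (cdom i `&` cdom j `&` U).

Definition transition (i j : chart M) : 'rV[R]_n -> 'rV[R]_n :=
  cmap j \o cinv i.

Definition diffeomorphic_to (B : set 'rV[R]_n) : Prop :=
  exists (f : M -> 'rV[R]_n) (h : 'rV[R]_n -> M),
    [/\ (forall p, U p -> B (f p) /\ h (f p) = p),
        (forall y, B y -> U (h y) /\ f (h y) = y),
        (forall y, B y -> {for y, continuous h}),
        (forall i, smooth_on (creg i) (f \o cinv i)) &
        (forall i, smooth_on [set y | B y /\ cdom i (h y)] (cmap i \o h))].

Definition star_shaped_region : Prop :=
  open U /\ exists (c : 'rV[R]_n) (r : R),
              0 < r /\ diffeomorphic_to (euclidean_ball c r).

(* Gram matrices of the metric in the charts. With row vectors, a tangent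
   vector v at x in the chart i reads [v *m 'J (transition i j) x] in j. *)
Record riemannian_metric := RiemannianMetric {
  gram :> chart M -> 'rV[R]_n -> 'M[R]_n ;
  gram_sym : forall i x, creg i x -> (gram i x)^T = gram i x ;
  gram_posdef : forall i x, creg i x -> forall v : 'rV[R]_n, v != 0 ->
    0 < (v *m gram i x *m v^T) 0 0 ;
  gram_smooth : forall i a b, smooth_on (creg i) (fun x => gram i x a b : R) ;
  gram_compat : forall i j x, coverlap i j x ->
    let J := jacobian (transition i j) x in
    gram i x = J *m gram j (transition i j x) *m J^T
}.

(* [osign i x] is 1 or -1 according to whether the coordinate frame of the
   chart i at x is positively or negatively oriented. *)
Record orientation := Orientation {
  osign :> chart M -> 'rV[R]_n -> R ;
  osign_val : forall i x, creg i x -> osign i x = 1 \/ osign i x = -1 ;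
  osign_continuous : forall i x, creg i x -> {for x, continuous (osign i)} ;
  osign_compat : forall i j x, coverlap i j x ->
    osign i x =
    Num.sg (\det (jacobian (transition i j) x)) * osign j (transition i j x)
}.

End OpenSubset.

Section ExteriorAlgebra.
Context (R : realType) (n : nat).

Definition alternating_form (k : nat) (f : 'M[R]_(k, n) -> R) : Prop :=
  (forall (A B C : 'M[R]_(k, n)) (i0 : 'I_k) (b c : R),
     row i0 A = b *: row i0 B + c *: row i0 C ->
     row' i0 B = row' i0 A -> row' i0 C = row' i0 A ->
     f A = b * f B + c * f C) /\
  (forall (A : 'M[R]_(k, n)) (i1 i2 : 'I_k),
     i1 != i2 -> row i1 A = row i2 A -> f A = 0).

(* Hodge star from degree r to degree s, for r + s = n, of the inner product
   with Gram matrix [G] and the orientation sign [o]: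
     (star f)_{j_1 .. j_s} = 1/r! f^{i_1 .. i_r} vol_{i_1 .. i_r j_1 .. j_s},
   with vol = o sqrt(det G) dx^1 /\ .. /\ dx^n, so that
   f /\ star f' = <f, f'> vol. Indices are raised by evaluating [f] on rows of
   G^-1. When r + s = n, [conform_mx] is just the cast of the square
   matrix [col_mx ..] to ['M_n]. *)
Definition hodge (G : 'M[R]_n) (o : R) (r s : nat) (f : 'M[R]_(r, n) -> R) :
    'M[R]_(s, n) -> R :=
  fun V => (r`!%:R)^-1 * \sum_(I : {ffun 'I_r -> 'I_n})
    f (rowsub I (invmx G)) *
    (o * Num.sqrt (\det G) *
     \det (conform_mx (0 : 'M[R]_n) (col_mx (rowsub I (1%:M : 'M[R]_n)) V))).

(* Inverse of [hodge G o r s] on alternating forms. *)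
Definition hodge_inv (G : 'M[R]_n) (o : R) (r s : nat)
    (h : 'M[R]_(s, n) -> R) : 'M[R]_(r, n) -> R :=
  xget (fun=> 0)
    [set f : 'M[R]_(r, n) -> R | alternating_form f /\ hodge G o f = h].

End ExteriorAlgebra.

Section DifferentialForms.
Context (R : realType) (n : nat) (M : manifold R n) (U : set M).

(* A field of k-forms written in every chart. The operators below act on such
   families; only the values on [creg U i] are relevant. *)
Definition local_forms (k : nat) : Type :=
  chart M -> 'rV[R]_n -> 'M[R]_(k, n) -> R.

Record diff_form (k : nat) := DiffForm {
  form_val :> local_forms k ;
  form_alternating : forall i x, creg U i x -> alternating_form (form_val i x) ;
  form_smooth : forall i (V : 'M[R]_(k, n)),
    smooth_on (creg U i) (fun x => form_val i x V : R) ;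
  form_compat : forall i j x, coverlap U i j x -> forall V : 'M[R]_(k, n),
    form_val i x V =
    form_val j (transition i j x) (V *m jacobian (transition i j) x)
}.

Definition form_eq (k : nat) (w1 w2 : local_forms k) : Prop :=
  forall i x, creg U i x -> w1 i x = w2 i x.

Definition form_zero (k : nat) : local_forms k := fun _ _ _ => 0.

Definition grading (k : nat) (w : local_forms k) : local_forms k :=
  fun i x V => (-1) ^+ k * w i x V.

(* dw(v_0, .., v_k) = sum_a (-1)^a d/dv_a [w(v_0, .., v_a omitted, .., v_k)]
   for constant vector fields v_0, .., v_k in a chart. *)
Definition ext_deriv (k : nat) (w : local_forms k) : local_forms k.+1 :=
  fun i x V => \sum_(a < k.+1)
    (-1) ^+ a * 'D_(row a V) (fun y => w i y (row' a V) : R) x.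

Context (g : riemannian_metric U) (o : orientation U).

Definition star (r s : nat) (w : local_forms r) : local_forms s :=
  fun i x => hodge (g i x) (o i x) (w i x).

Definition star_inv (r s : nat) (w : local_forms s) : local_forms r :=
  fun i x => hodge_inv (g i x) (o i x) (w i x).

(* On k-forms, 0 < k <= n: star^-1 d star eta, through the degrees
   k, n - k, n - k + 1 and k - 1. *)
Definition codiff (k : nat) : local_forms k -> local_forms k.-1 :=
  match k return local_forms k -> local_forms k.-1 with
  | 0 => fun _ => @form_zero 0
  | k'.+1 => fun w =>
      @star_inv k' _ (ext_deriv (@star _ (n - k'.+1) (grading w)))
  end.

End DifferentialForms.

Arguments form_zero {R n} M k _ _ _.

(* Main.v *)
(* The codifferential is star^-1 d star up to sign, so "delta w = 0 implies
   w = delta a" is the Poincare lemma for star w, carried back by star^-1, which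
   is star up to a nonzero constant. Closedness of star w follows from
   delta w = 0 because star is injective on alternating forms; for k = 0 it is
   automatic, d (star w) having degree n + 1.
   The diffeomorphism from U to a ball turns star w into a closed form on the
   ball, given near each point by the pullback from any chart. Its primitive is
   the integral along rays of the contraction with the radial field, and is
   pulled back to the charts. The second derivatives in the naturality of d
   cancel by their symmetry once d is written as a sum over all permutations. *)
Require Import Defs.
From HB Require Import structures.
From mathcomp Require Import all_boot all_order all_algebra all_fingroup.
From mathcomp Require Import all_classical all_reals all_analysis.
From mathcomp Require Import ring lra.
Set Implicit Arguments.
Unset Strict Implicit.
Unset Printing Implicit Defensive.
Import Order.TTheory GRing.Theory Num.Theory.
Import numFieldNormedType.Exports.
Local Open Scope classical_set_scope.
Local Open Scope ring_scope.

(** * Alternating forms *)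

Section Multilinear.
Context (R : realType) (n : nat).

(** The delicate point of [codiff] is its inverse star: an [xget] choice among alternating
    preimages, with the zero form as default. Vanishing of the codifferential is therefore
    informative only once d(star w) is known to be a star. The double star formula supplies this
    together with injectivity, and its constant depends on the degrees alone, not on the metric, the
    orientation or the point, so it passes through d. Components are summed over all index tuples
    rather than increasing ones; this is the origin of the factorials. On the analytic side,
    smoothness speaks of all iterated directional derivatives, so each closure property must be
    shown at every order at once; this is done by exhibiting classes of functions stable under
    differentiation. Differentiation under the ray integral comes from a second order Taylor bound,
    uniform on a compact set that contains all rays to nearby points. No partition of unity enters:
    the chart pullbacks agree on overlaps, so they already define one form on the ball. *)

Definition set_row k (V : 'M[R]_(k, n)) (b : 'I_k) (u : 'rV[R]_n) : 'M[R]_(k, n) :=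
  \matrix_(a, j) if a == b then u 0 j else V a j.

Lemma row_set_row k (V : 'M[R]_(k, n)) b u a :
  row a (set_row V b u) = if a == b then u else row a V.
Proof. by apply/rowP => j; rewrite !mxE; case: ifP => // _; rewrite !mxE. Qed.

Lemma set_row_id k (V : 'M[R]_(k, n)) b : set_row V b (row b V) = V.
Proof. by apply/row_matrixP => a; rewrite row_set_row; case: eqP => [->|]. Qed.

Lemma set_rowC k (V : 'M[R]_(k, n)) a b u v : a != b ->
  set_row (set_row V a u) b v = set_row (set_row V b v) a u.
Proof.
move=> ab; apply/row_matrixP => c; rewrite !row_set_row.
by case: eqP => [->|//]; rewrite eq_sym (negPf ab).
Qed.

Lemma row'_eqP k (A B : 'M[R]_(k, n)) i :
  row' i B = row' i A <-> forall a, a != i -> row a B = row a A.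
Proof.
split=> [e a ai|e].
  have /unlift_some[a' -> _] : i != a by rewrite eq_sym.
  by apply/rowP => j; have /matrixP/(_ a' j) := e; rewrite !mxE.
apply/matrixP => a j; have := e (lift i a); rewrite eq_sym neq_lift => /(_ isT).
by move/rowP/(_ j); rewrite !mxE.
Qed.

Definition mlinear k (f : 'M[R]_(k, n) -> R) := forall V b u v (s t : R),
  f (set_row V b (s *: u + t *: v)) = s * f (set_row V b u) + t * f (set_row V b v).

Definition vanish_eq k (f : 'M[R]_(k, n) -> R) :=
  forall V (i j : 'I_k), i != j -> row i V = row j V -> f V = 0.

(** Three matrices agreeing off one row are three values of [set_row] on one matrix, so the
    relational definition becomes an equation fit for rewriting. *)
Lemma alternating_formP k (f : 'M[R]_(k, n) -> R) :
  alternating_form f <-> mlinear f /\ vanish_eq f.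
Proof.
split=> -[f1 f2]; split=> //.
  move=> V b u v s t; apply: (f1 _ _ _ b).
  - by rewrite !row_set_row eqxx.
  - by apply/row'_eqP => a ab; rewrite !row_set_row (negPf ab).
  - by apply/row'_eqP => a ab; rewrite !row_set_row (negPf ab).
move=> A B C i b c Ai /row'_eqP BA /row'_eqP CA.
have setE (D : 'M[R]_(k, n)) : (forall a, a != i -> row a D = row a A) ->
    D = set_row A i (row i D).
  move=> DA; apply/row_matrixP => a; rewrite row_set_row.
  by case: eqVneq => [->//|/DA].
by rewrite [in LHS](setE A)// Ai f1 -(setE _ BA) -(setE _ CA).
Qed.

Lemma mlinear_sum k (f : 'M[R]_(k, n) -> R) V b (I : finType) (c : I -> R) u :
  mlinear f ->
  f (set_row V b (\sum_i c i *: u i)) = \sum_i c i * f (set_row V b (u i)).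
Proof.
move=> fl; elim/big_rec2: _ => [|i x y _ <-].
  by have := fl V b 0 0 0 0; rewrite !scale0r !mul0r !addr0.
by have := fl V b (u i) y (c i) 1; rewrite scale1r mul1r.
Qed.

Lemma mlinear_comp k (f : 'M[R]_(k, n) -> R) (Q : 'M[R]_n) :
  mlinear f -> mlinear (fun V => f (V *m Q)).
Proof.
have E V b u : set_row V b u *m Q = set_row (V *m Q) b (u *m Q).
  by apply/row_matrixP => a; rewrite row_mul !row_set_row; case: eqP; rewrite // row_mul.
by move=> fl V b u v s t; rewrite !E mulmxDl -!scalemxAl fl.
Qed.

Lemma alternating_comp k (f : 'M[R]_(k, n) -> R) (Q : 'M[R]_n) :
  alternating_form f -> alternating_form (fun V => f (V *m Q)).
Proof.
move=> /alternating_formP[fl fv]; apply/alternating_formP; split.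
  exact: mlinear_comp.
by move=> V i j ij Vij; apply: (fv _ _ _ ij); rewrite !row_mul Vij.
Qed.

Lemma alternating_scale k (f : 'M[R]_(k, n) -> R) (c : R) :
  alternating_form f -> alternating_form (fun V => c * f V).
Proof.
move=> /alternating_formP[fl fv]; apply/alternating_formP; split.
  by move=> V b u v s t; rewrite fl mulrDr !mulrA ![c * _]mulrC.
by move=> V i j ij Vij; rewrite (fv _ _ _ ij Vij) mulr0.
Qed.

Lemma alternating_sum k (I : finType) (f : I -> 'M[R]_(k, n) -> R) :
  (forall i, alternating_form (f i)) -> alternating_form (fun V => \sum_i f i V).
Proof.
move=> fa; apply/alternating_formP; split.
  move=> V b u v s t; rewrite !big_distrr -big_split; apply: eq_bigr => i _.
  by have /alternating_formP[-> _] := fa i.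
move=> V i j ij Vij; apply: big1 => a _.
by have /alternating_formP[_ /(_ _ _ _ ij Vij)] := fa a.
Qed.

(** Filling the first slot of a form in this way is the interior product with [u]. *)
Definition cons_row k (u : 'rV[R]_n) (W : 'M[R]_(k, n)) : 'M[R]_(k.+1, n) :=
  \matrix_(a, j) if unlift ord0 a is Some b then W b j else u 0 j.

Lemma row_cons0 k u (W : 'M[R]_(k, n)) : row ord0 (cons_row u W) = u.
Proof. by apply/rowP => j; rewrite !mxE unlift_none. Qed.

Lemma row_consS k u (W : 'M[R]_(k, n)) a :
  row (lift ord0 a) (cons_row u W) = row a W.
Proof. by apply/rowP => j; rewrite !mxE liftK. Qed.

Lemma row'_cons0 k u (W : 'M[R]_(k, n)) : row' ord0 (cons_row u W) = W.
Proof. by apply/matrixP => a j; rewrite !mxE liftK. Qed.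

Lemma row_row' k (V : 'M[R]_(k.+1, n)) i a :
  row a (row' i V) = row (lift i a) V.
Proof. by apply/rowP => j; rewrite !mxE. Qed.

Lemma cons_row_eta k (V : 'M[R]_(k.+1, n)) : cons_row (row ord0 V) (row' ord0 V) = V.
Proof. by apply/matrixP => a j; rewrite !mxE; case: unliftP => [b|] ->; rewrite ?mxE. Qed.

Lemma eq_cons_row k (V : 'M[R]_(k.+1, n)) u W :
  row ord0 V = u -> row' ord0 V = W -> V = cons_row u W.
Proof. by move=> <- <-; rewrite cons_row_eta. Qed.

Lemma row'_lift_cons k u (W : 'M[R]_(k.+1, n)) (a : 'I_k.+1) :
  row' (lift ord0 a : 'I_k.+2) (cons_row u W) = cons_row u (row' a W).
Proof.
apply: eq_cons_row.
  rewrite row_row' (_ : lift (lift ord0 a : 'I_k.+2) (ord0 : 'I_k.+1) = ord0) ?row_cons0//.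
  exact/val_inj.
apply/row_matrixP => b; rewrite !row_row'.
rewrite (_ : lift (lift ord0 a : 'I_k.+2) (lift ord0 b : 'I_k.+1) = lift ord0 (lift a b)) ?row_consS//.
by apply/val_inj; rewrite /= /bump /= !add1n ltnS addnS.
Qed.

Lemma set_row_cons0 k u v (W : 'M[R]_(k, n)) :
  set_row (cons_row u W) ord0 v = cons_row v W.
Proof.
apply: eq_cons_row; first by rewrite row_set_row eqxx.
apply/row_matrixP => a; rewrite row_row' row_set_row eq_sym.
by rewrite (negPf (neq_lift _ _)) row_consS.
Qed.

Lemma set_row_consS k u v (W : 'M[R]_(k, n)) b :
  set_row (cons_row u W) (lift ord0 b) v = cons_row u (set_row W b v).
Proof.
apply: eq_cons_row; first by rewrite row_set_row (negPf (neq_lift _ _)) row_cons0.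
apply/row_matrixP => a; rewrite row_row' !row_set_row row_consS.
by rewrite (inj_eq (@lift_inj _ _)).
Qed.

Lemma mlinear_cons k (f : 'M[R]_(k.+1, n) -> R) u :
  mlinear f -> mlinear (fun W => f (cons_row u W)).
Proof. by move=> fl V b v w s t; rewrite -!set_row_consS fl. Qed.

Lemma mlinear_cons_sum k (f : 'M[R]_(k.+1, n) -> R) (I : finType) (c : I -> R) u W :
  mlinear f ->
  f (cons_row (\sum_i c i *: u i) W) = \sum_i c i * f (cons_row (u i) W).
Proof.
move=> fl; rewrite -(set_row_cons0 0) mlinear_sum//.
by under eq_bigr do rewrite set_row_cons0.
Qed.

(** Tuples of standard basis vectors, in any order and with repetitions; the values of a form on
    them are its components. *)
Definition basis_rows k (L : {ffun 'I_k -> 'I_n}) : 'M[R]_(k, n) := rowsub L 1%:M.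

Lemma big_ffunS k (F : {ffun 'I_k.+1 -> 'I_n} -> R) :
  \sum_L F L = \sum_j \sum_(L : {ffun 'I_k -> 'I_n})
    F [ffun a => if unlift ord0 a is Some b then L b else j].
Proof.
rewrite pair_big /=.
rewrite (reindex (fun p : 'I_n * {ffun 'I_k -> 'I_n} =>
  [ffun a => if unlift ord0 a is Some b then p.2 b else p.1]))//=.
exists (fun L => (L ord0, [ffun a => L (lift ord0 a)])) => [[j L] _|L _].
  congr (_, _); first by rewrite ffunE unlift_none.
  by apply/ffunP => a; rewrite !ffunE liftK.
by apply/ffunP => a; rewrite !ffunE; case: unliftP => [b|] ->; rewrite ?ffunE.
Qed.

(** Induction on the number of rows: the first row is expanded in the standard basis, and the
    induction hypothesis is applied to the interior products with the basis vectors. *)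
Lemma mlinear_expand k (f : 'M[R]_(k, n) -> R) V : mlinear f ->
  f V = \sum_(L : {ffun 'I_k -> 'I_n}) (\prod_a V a (L a)) * f (basis_rows L).
Proof.
elim: k f V => [|k IH] f V fl.
  have card0 : #|'I_0| = 0%N by rewrite card_ord.
  pose L0 : {ffun 'I_0 -> 'I_n} := ffun0 card0.
  rewrite (bigD1 L0)//= big_ord0 mul1r [X in _ + X]big1 ?addr0 => [|L /eqP nL].
    by congr f; apply/matrixP; case.
  by case: nL; apply/ffunP; case.
rewrite big_ffunS -{1}(cons_row_eta V) {1}(row_sum_delta (row ord0 V)).
rewrite (mlinear_cons_sum (row ord0 V 0) (fun j => delta_mx 0 j))//; apply: eq_bigr => j _.
rewrite (IH _ _ (mlinear_cons (delta_mx 0 j) fl)) big_distrr/=; apply: eq_bigr => L _.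
rewrite big_ord_recl ffunE unlift_none mxE -!mulrA; congr (_ * (_ * _)).
  by apply: eq_bigr => a _; rewrite ffunE liftK !mxE.
congr f; apply/esym/eq_cons_row.
  by apply/rowP => i; rewrite !mxE ffunE unlift_none eqxx eq_sym.
by apply/matrixP => a i; rewrite !mxE ffunE liftK.
Qed.

(** Polarisation: placing the sum of the two rows in both slots gives 0, and of the four terms of
    the expansion only the two mixed ones survive. *)
Lemma alternating_tperm k (f : 'M[R]_(k, n) -> R) V i j : alternating_form f ->
  i != j -> f (row_perm (tperm i j) V) = - f V.
Proof.
move=> /alternating_formP[fl fv] ij.
pose V2 u v := set_row (set_row V i u) j v.
have V2E u v : V2 u v = set_row (set_row V j v) i u by rewrite /V2 set_rowC.
have V2v u : f (V2 u u) = 0.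
  by apply: (fv _ _ _ ij); rewrite !row_set_row eqxx (negPf ij) eqxx.
have lin1 u u' v : f (V2 (u + u') v) = f (V2 u v) + f (V2 u' v).
  by have := fl (set_row V j v) i u u' 1 1; rewrite !V2E !scale1r !mul1r.
have lin2 u v v' : f (V2 u (v + v')) = f (V2 u v) + f (V2 u v').
  by have := fl (set_row V i u) j v v' 1 1; rewrite !scale1r !mul1r.
have := V2v (row i V + row j V); rewrite lin1 !lin2 !V2v add0r addr0.
rewrite {1}/V2 !set_row_id => /eqP; rewrite addr_eq0 => /eqP ->; rewrite opprK.
congr f; apply/row_matrixP => a; rewrite /V2 !row_set_row.
apply/rowP => l; rewrite !mxE.
case: (eqVneq a j) => [->|aj]; first by rewrite tpermR mxE.
case: (eqVneq a i) => [->|ai]; first by rewrite tpermL mxE.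
by rewrite tpermD 1?eq_sym// mxE.
Qed.

Lemma alternating_row_perm k (f : 'M[R]_(k, n) -> R) (s : 'S_k) V :
  alternating_form f -> f (row_perm s V) = (-1) ^+ s * f V.
Proof.
move=> fa; have [ts -> dts] := prod_tpermP s.
elim: ts dts => [|t ts IH] /=.
  by rewrite big_nil row_perm1 odd_perm1 mul1r.
move=> /andP[dt dts]; rewrite big_cons row_permM alternating_tperm// IH//.
by rewrite odd_mul_tperm dt signr_addb expr1 !mulN1r mulNr.
Qed.

(** The algebraic skeleton of the exterior derivative: [h u W] stands for the derivative along [u]
    of the form evaluated on [W]. Isolating it separates the sign combinatorics from the
    calculus. *)
Definition asum k (h : 'rV[R]_n -> 'M[R]_(k, n) -> R) (V : 'M[R]_(k.+1, n)) : R :=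
  \sum_(a < k.+1) (-1) ^+ a * h (row a V) (row' a V).

(* Turns the cancellations in [d] into the symmetry of a sum over the whole
   permutation group. *)
Lemma asum_perm k (h : 'rV[R]_n -> 'M[R]_(k, n) -> R) V :
  (forall u, alternating_form (h u)) ->
  k`!%:R * asum h V = \sum_(s : 'S_k.+1)
    (-1) ^+ s * h (row ord0 (row_perm s V)) (row' ord0 (row_perm s V)).
Proof.
move=> ha.
(* A permutation amounts to the image [a] of the first index and a permutation of the rest; for
   fixed [a] the k! signed terms coincide. *)
have inj : injective (fun p : 'I_k.+1 * 'S_k => lift_perm ord0 p.1 p.2).
  move=> [a s] [b t] /= e.
  have ab : a = b by rewrite -(lift_perm_id ord0 a s) e lift_perm_id.
  congr (_, _) => //; apply/permP => c; apply: (@lift_inj _ a).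
  by rewrite -(lift_perm_lift ord0) e ab lift_perm_lift.
rewrite (reindex (fun p : 'I_k.+1 * 'S_k => lift_perm ord0 p.1 p.2)); last first.
  apply: onW_bij; apply: inj_card_bij => //.
  by rewrite card_prod card_ord !card_Sn factS.
rewrite -(pair_big xpredT xpredT (fun a s => (-1) ^+ lift_perm ord0 a s *
  h (row ord0 (row_perm (lift_perm ord0 a s) V))
    (row' ord0 (row_perm (lift_perm ord0 a s) V))))/=.
rewrite /asum big_distrr; apply: eq_bigr => a _.
rewrite (eq_bigr (fun=> (-1) ^+ a * h (row a V) (row' a V))).
  rewrite sumr_const -card_Sn /= mulr_natl; congr (_ *+ _); exact: eq_card.
move=> s _.
have -> : row ord0 (row_perm (lift_perm ord0 a s) V) = row a V.
  by apply/rowP => j; rewrite !mxE lift_perm_id.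
have -> : row' ord0 (row_perm (lift_perm ord0 a s) V) = row_perm s (row' a V).
  by apply/matrixP => i j; rewrite !mxE lift_perm_lift.
rewrite alternating_row_perm// odd_lift_perm /= mulrA -signr_addb -addbA addbb addbF.
by rewrite signr_odd.
Qed.

(** Exchanging two positions keeps [T] and reverses the sign, so the sum equals its own negative.
    This disposes of the second derivative terms in the naturality of d. *)
Lemma tperm_sum0 k (T : 'M[R]_(k, n) -> R) (i j : 'I_k) V : i != j ->
  (forall s : 'S_k, T (row_perm (tperm i j * s) V) = T (row_perm s V)) ->
  \sum_(s : 'S_k) (-1) ^+ s * T (row_perm s V) = 0.
Proof.
move=> ij TE; set S := \sum_s _; suff : S = - S.
  by move=> /eqP; rewrite -addr_eq0 -mulr2n mulrn_eq0 => /eqP.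
rewrite {1}/S (reindex_inj (mulgI (tperm i j))) -sumrN; apply: eq_bigr => s _.
by rewrite TE odd_mul_tperm ij signr_addb expr1 mulN1r mulNr.
Qed.

(** In the sum over permutations, composing with the transposition of [i] and [j] on the side that
    acts on [V] leaves [V] unchanged, its two rows being equal, and reverses every sign. *)
Lemma asum_vanish k (h : 'rV[R]_n -> 'M[R]_(k, n) -> R) :
  (forall u, alternating_form (h u)) -> vanish_eq (asum h).
Proof.
move=> ha V i j ij Vij.
have kn0 : k`!%:R != 0 :> R by rewrite pnatr_eq0 -lt0n fact_gt0.
apply: (mulfI kn0); rewrite mulr0 asum_perm//.
have VE : row_perm (tperm i j) V = V.
  apply/row_matrixP => a; apply/rowP => l; rewrite !mxE.
  have /rowP/(_ l) := Vij; rewrite !mxE => e.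
  by case: tpermP => [->|->|].
set S := \sum_s _; suff : S = - S.
  by move=> /eqP; rewrite -addr_eq0 -mulr2n mulrn_eq0 => /eqP.
rewrite {1}/S (reindex_inj (mulIg (tperm i j))) -sumrN; apply: eq_bigr => s _.
by rewrite row_permM VE odd_permM odd_tperm ij addbT signrN mulNr.
Qed.

Lemma asum_mlinear k (h : 'rV[R]_n -> 'M[R]_(k, n) -> R) :
  (forall u, mlinear (h u)) ->
  (forall u v s t W, h (s *: u + t *: v) W = s * h u W + t * h v W) ->
  mlinear (asum h).
Proof.
move=> hl h1 V b u v s t; rewrite /asum !big_distrr -big_split; apply: eq_bigr => a _ /=.
rewrite !(mulrCA _ ((-1) ^+ a)) -mulrDr; congr (_ * _).
have [<-|ab] := eqVneq a b.
  rewrite !row_set_row eqxx h1; congr (s * h _ _ + t * h _ _);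
  by apply/row_matrixP => c; rewrite !row_row' !row_set_row !(eq_sym _ a) (negPf (neq_lift _ _)).
rewrite !row_set_row (negPf ab).
have [b' bE _] := unlift_some ab.
have E w : row' a (set_row V b w) = set_row (row' a V) b' w.
  apply/row_matrixP => c; rewrite !row_row' !row_set_row row_row' bE.
  by rewrite (inj_eq (@lift_inj _ _)).
by rewrite !E hl.
Qed.

Lemma asum_alternating k (h : 'rV[R]_n -> 'M[R]_(k, n) -> R) :
  (forall u, alternating_form (h u)) ->
  (forall u v s t W, h (s *: u + t *: v) W = s * h u W + t * h v W) ->
  alternating_form (asum h).
Proof.
move=> ha h1; apply/alternating_formP; split; last exact: asum_vanish.
by apply: asum_mlinear => // u; have /alternating_formP[] := ha u.
Qed.

(** Pigeonhole: more than [n] basis vectors of an [n]-dimensional space contain a repetition, so all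
    components vanish. *)
Lemma alternating_gt_dim k (f : 'M[R]_(k, n) -> R) V :
  alternating_form f -> (n < k)%N -> f V = 0.
Proof.
move=> /alternating_formP[fl fv] nk; rewrite mlinear_expand// big1// => L _.
have /injectivePn[a [b ab Lab]] : ~~ injectiveb L.
  apply: contraL nk => /injectiveP/leq_card; rewrite !card_ord -leqNgt; exact.
rewrite (fv _ _ _ ab) ?mulr0//.
by apply/rowP => j; rewrite !mxE Lab.
Qed.
End Multilinear.

(** * The Hodge star of an inner product *)

Section Hodge.
Context (R : realType) (n : nat).

Lemma basis_rowsM k p (I : {ffun 'I_k -> 'I_n}) (P : 'M[R]_(n, p)) a j :
  (basis_rows R I *m P) a j = P (I a) j.
Proof. by rewrite -rowsubE mxE. Qed.

(** Both sides are full contractions over all index tuples, and a matrix acting on each index of one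
    factor passes to the other factor as its transpose. This moves the index raising from the form
    to the volume. *)
Lemma mlinear_contract k (f h : 'M[R]_(k, n) -> R) (P : 'M[R]_n) :
  mlinear f -> mlinear h ->
  \sum_I f (basis_rows R I *m P) * h (basis_rows R I) =
  \sum_I f (basis_rows R I) * h (basis_rows R I *m P^T).
Proof.
move=> fl hl.
under eq_bigr do rewrite (mlinear_expand _ fl) big_distrl /=.
rewrite exchange_big; apply: eq_bigr => L _.
rewrite (mlinear_expand (_ *m _) hl) big_distrr /=; apply: eq_bigr => I _.
rewrite -mulrA mulrCA; congr (_ * (_ * _)).
by apply: eq_bigr => a _; rewrite !basis_rowsM mxE.
Qed.

(** The Euclidean volume form on [r] + [s] = [n] vectors split into two blocks. *)
Definition vdet r s (A : 'M[R]_(r, n)) (B : 'M[R]_(s, n)) : R :=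
  \det (conform_mx (0 : 'M[R]_n) (col_mx A B)).

Lemma det_vanish_eq : vanish_eq (fun M : 'M[R]_n => \det M).
Proof.
move=> M i j ij Mij; apply: (determinant_alternate ij) => l.
by have /rowP/(_ l) := Mij; rewrite !mxE.
Qed.

Lemma det_mlinear : mlinear (fun M : 'M[R]_n => \det M).
Proof.
move=> V b u v s t; apply: (@determinant_multilinear _ _ _ _ _ b).
- by rewrite !row_set_row eqxx.
- by apply/row'_eqP => a ab; rewrite !row_set_row (negPf ab).
- by apply/row'_eqP => a ab; rewrite !row_set_row (negPf ab).
Qed.
End Hodge.

(** * Determinants of two stacked blocks of rows *)

Section BlockDeterminants.
Context (R : realType) (r s n : nat) (rsn : (r + s)%N = n).
Implicit Types (A : 'M[R]_(r, n)) (B : 'M[R]_(s, n)).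

Lemma vdetM A B (Q : 'M[R]_n) : vdet (A *m Q) (B *m Q) = vdet A B * \det Q.
Proof.
rewrite /vdet; case: _ / rsn A B Q => A B Q.
by rewrite !conform_mx_id -mul_col_mx det_mulmx.
Qed.

Lemma vdet_altr A : alternating_form (vdet A : 'M[R]_(s, n) -> R).
Proof.
apply/alternating_formP; rewrite /vdet; case: _ / rsn A => A; split.
  have E V b u : col_mx A (set_row V b u) = set_row (col_mx A V) (rshift r b) u.
    apply/row_matrixP => c; rewrite row_set_row; case: (split_ordP c) => a ->.
      by rewrite eq_lrshift !rowKu.
    by rewrite !rowKd row_set_row (inj_eq (@rshift_inj _ _)).
  by move=> V b u v x y; rewrite !conform_mx_id !E det_mlinear.
move=> V i j ij Vij; rewrite conform_mx_id.
by apply: (@det_vanish_eq _ _ _ (rshift r i) (rshift r j));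
  rewrite ?rowKd ?(inj_eq (@rshift_inj _ _)).
Qed.

Lemma vdet_altl B : alternating_form (fun A => vdet A B).
Proof.
apply/alternating_formP; rewrite /vdet; case: _ / rsn B => B; split.
  have E V b u : col_mx (set_row V b u) B = set_row (col_mx V B) (lshift s b) u.
    apply/row_matrixP => c; rewrite row_set_row; case: (split_ordP c) => a ->.
      by rewrite !rowKu row_set_row (inj_eq (@lshift_inj _ _)).
    by rewrite !rowKd eq_rlshift.
  by move=> V b u v x y; rewrite !conform_mx_id !E det_mlinear.
move=> V i j ij Vij; rewrite conform_mx_id.
by apply: (@det_vanish_eq _ _ _ (lshift s i) (lshift s j));
  rewrite ?rowKu ?(inj_eq (@lshift_inj _ _)).
Qed.

(** The constant is the determinant of the block permutation matrix, that is (-1)^(rs). Only its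
    being nonzero and independent of the blocks matters, and the former follows from orthogonality
    of that matrix. *)
Lemma vdet_swap : exists2 e : R, e != 0 & forall A B, vdet B A = e * vdet A B.
Proof.
rewrite /vdet; case: _ / rsn.
pose P : 'M[R]_(s + r, r + s) := col_mx (row_mx 0 1%:M) (row_mx 1%:M 0).
exists (\det (castmx (addnC s r, erefl) P)) => [|A B].
  have PP : P *m P^T = 1%:M.
    rewrite /P tr_col_mx !tr_row_mx !trmx0 !trmx1 mul_col_row !mul_row_col.
    by rewrite !mul0mx !mulmx0 !mul1mx !addr0 add0r -scalar_mx_block.
  have key m (e : m = (r + s)%N) (Q : 'M[R]_(m, r + s)) :
      Q *m Q^T = 1%:M -> \det (castmx (e, erefl) Q) != 0.
    subst m => QQ; rewrite castmx_id; apply/eqP => Q0.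
    by have /eqP := congr1 determinant QQ; rewrite det_mulmx Q0 mul0r det1 eq_sym oner_eq0.
  exact: key.
rewrite -(conform_castmx (addnC s r, erefl)) !conform_mx_id -det_mulmx.
congr (\det _).
have castM m (e : m = (r + s)%N) (Q : 'M[R]_(m, r + s)) (C : 'M[R]_(r + s)) :
    castmx (e, erefl) (Q *m C) = castmx (e, erefl) Q *m C.
  by subst m; rewrite !castmx_id.
by rewrite -castM /P mul_col_mx !mul_row_col !mul0mx !mul1mx add0r addr0.
Qed.

(** If [K] lists the complement of [I], multiplying the rows of [A] and e_K by the transpose of the
    rows e_I and e_K gives a block triangular matrix with diagonal blocks A e_I^T and 1. Otherwise a
    basis vector is repeated and the first factor is 0. *)
Lemma vdet_basis_mul (I : {ffun 'I_r -> 'I_n}) (K : {ffun 'I_s -> 'I_n}) A :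
  injectiveb I ->
  vdet (basis_rows R I) (basis_rows R K) * vdet A (basis_rows R K) =
  if (K \in ffun_on [predC codom I]) && injectiveb K
  then \det (A *m (basis_rows R I)^T) else 0.
Proof.
move=> /injectiveP Iinj; case: ifPn => [/andP[/ffun_onP Kon /injectiveP Kinj]|].
  rewrite /vdet; case: _ / rsn I K A Iinj Kon Kinj => I K A Iinj Kon Kinj.
  rewrite !conform_mx_id -det_tr mulrC -det_mulmx tr_col_mx mul_col_row.
  have -> : basis_rows R K *m (basis_rows R I)^T = 0.
    apply/matrixP => b a; rewrite basis_rowsM !mxE.
    case: eqP => // KI; have := Kon b; rewrite !inE.
    by rewrite -KI codom_f.
  have -> : basis_rows R K *m (basis_rows R K)^T = 1%:M.
    apply/matrixP => b a; rewrite basis_rowsM !mxE.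
    by rewrite (inj_eq Kinj) eq_sym.
  by rewrite det_ublock det1 mulr1.
rewrite negb_and => /orP[/ffun_onP/existsNP[b]|/injectivePn[b [c bc Kbc]]]; last first.
  have /alternating_formP[_ /(_ _ _ _ bc) ->] := vdet_altr (basis_rows R I).
    by rewrite mul0r.
  by apply/rowP => j; rewrite !mxE Kbc.
rewrite !inE => /negP; rewrite negbK => /codomP[a KI].
suff -> : vdet (basis_rows R I) (basis_rows R K) = 0 by rewrite mul0r.
rewrite /vdet; case: _ / rsn I K {A Iinj} KI => I K KI.
rewrite conform_mx_id; apply: (@det_vanish_eq _ _ _ (lshift s a) (rshift r b)).
  by rewrite eq_lrshift.
by rewrite rowKu rowKd; apply/rowP => j; rewrite !mxE KI.
Qed.

(* Cauchy-Binet: the complementary s rows contract, since [vdet e_I e_K] is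
   nonzero only if I and K together enumerate the basis. *)
Lemma sum_vdet_basis (I : {ffun 'I_r -> 'I_n}) A :
  \sum_(K : {ffun 'I_s -> 'I_n}) vdet (basis_rows R I) (basis_rows R K) * vdet A (basis_rows R K) =
  s`!%:R * \det (A *m (basis_rows R I)^T).
Proof.
have [Iinj|/injectivePn[a [b ab Iab]]] := boolP (injectiveb I); last first.
  have Iv : row a (basis_rows R I) = row b (basis_rows R I).
    by apply/rowP => j; rewrite !mxE Iab.
  rewrite big1 => [|K _]; last first.
    have /alternating_formP[_ /(_ _ _ _ ab Iv) ->] := vdet_altl (basis_rows R K).
    by rewrite mul0r.
  rewrite -det_tr trmx_mul trmxK (_ : \det _ = 0) ?mulr0//.
  by apply: (det_vanish_eq ab); rewrite !row_mul Iv.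
under eq_bigr do rewrite vdet_basis_mul//.
rewrite -big_mkcond sumr_const mulr_natl; congr (_ *+ _).
have := card_inj_ffuns_on 'I_s [predC codom I].
rewrite cardsE card_ord.
have -> : #|[predC codom I]| = s.
  have := cardC (mem (codom I)); rewrite card_codom; last exact/injectiveP.
  by rewrite !card_ord -[in RHS]rsn => /addnI.
by rewrite ffactnn => <-; exact: eq_card.
Qed.

(** In the Leibniz expansion, the terms of a permutation [t] add up over all [I] to (-1)^t [f] at
    the permuted rows of [A], which is [f A]; there are r! permutations. *)
Lemma sum_alternating_det (f : 'M[R]_(r, n) -> R) A : alternating_form f ->
  \sum_I f (basis_rows R I) * \det (A *m (basis_rows R I)^T) = r`!%:R * f A.
Proof.
move=> fa; have /alternating_formP[fl _] := fa.
under eq_bigr do rewrite -det_tr trmx_mul trmxK /determinant big_distrr/=.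
rewrite exchange_big /= (eq_bigr (fun=> f A)) ?sumr_const ?card_Sn ?mulr_natl// => t _.
transitivity ((-1) ^+ t * f (row_perm t A)); last first.
  by rewrite alternating_row_perm// signrMK.
rewrite (mlinear_expand (row_perm t A) fl) big_distrr /=; apply: eq_bigr => I _.
rewrite mulrCA; congr (_ * _); rewrite mulrC; congr (_ * _).
by apply: eq_bigr => a _; rewrite basis_rowsM !mxE.
Qed.
End BlockDeterminants.

(** * Positive definite Gram matrices *)

Definition posdef (R : realType) n (G : 'M[R]_n) : Prop :=
  G^T = G /\ forall v : 'rV[R]_n, v != 0 -> 0 < (v *m G *m v^T) 0 0.

Lemma posdef_det_neq0 (R : realType) n (G : 'M[R]_n) : posdef G -> \det G != 0.
Proof.
move=> [_ Gpos]; apply/negP => /det0P[v v0 vG].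
by have := Gpos v v0; rewrite vG mul0mx mxE ltxx.
Qed.

(* The determinant does not vanish on the segment from G to the identity. *)
Lemma posdef_det_gt0 (R : realType) n (G : 'M[R]_n) : posdef G -> 0 < \det G.
Proof.
move=> Gpd; have [Gsym Gpos] := Gpd.
rewrite lt_neqAle eq_sym posdef_det_neq0//= leNgt; apply/negP => detG.
(* The determinant along the segment is a polynomial in the parameter, so the intermediate value
   theorem for polynomials yields a root if the ends differ in sign. *)
pose M : 'M[{poly R}]_n := (1 - 'X) *: map_mx polyC G + ('X)%:M.
have ME t : (\det M).[t] = \det ((1 - t) *: G + t%:M).
  rewrite -horner_evalE -det_map_mx; congr (\det _).
  apply/matrixP => a b; by rewrite !mxE /= horner_evalE hornerD hornerM !hornerE hornerMn hornerX.
have ends : (\det M).[0] <= 0 <= (\det M).[1].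
  rewrite !ME subr0 subrr scale1r scale0r add0r (_ : 0%:M = 0) ?addr0 ?det1 ?ler01 ?andbT.
    exact: ltW.
  by apply/matrixP => a b; rewrite !mxE mul0rn.
have [t /andP[t0 t1]] := poly_ivt ler01 ends.
rewrite rootE ME; apply/negP/posdef_det_neq0; split.
  by rewrite linearD/= linearZ/= tr_scalar_mx Gsym.
move=> v v0; rewrite mulmxDr mulmxDl -scalemxAr -scalemxAl mul_mx_scalar -scalemxAl.
rewrite mxE [X in X + _]mxE [X in _ + X]mxE.
have vv : 0 < (v *m v^T) 0 0.
  have [j vj] : exists j, v 0 j != 0.
    apply/existsP; apply: contraR v0 => /existsPn vj; apply/eqP/rowP => j.
    by apply/eqP; rewrite mxE -[_ == _]negbK vj.
  rewrite mxE (bigD1 j)//= !mxE ltr_wpDr//.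
    by apply: sumr_ge0 => i _; rewrite mxE -expr2 sqr_ge0.
  by rewrite -expr2 exprn_even_gt0.
have [->|t10] := eqVneq t 1; first by rewrite subrr mul0r add0r mul1r.
rewrite ltr_wpDr// ?mulr_ge0// ?(ltW vv)// mulr_gt0 ?Gpos// subr_gt0.
by rewrite lt_neqAle t10.
Qed.

Lemma posdef_unit (R : realType) n (G : 'M[R]_n) : posdef G -> G \in unitmx.
Proof. by move=> /posdef_det_neq0; rewrite unitmxE unitfE. Qed.

(** * Double star, change of coordinates and inverse star *)

Section HodgeStar.
Context (R : realType) (r s n : nat) (rsn : (r + s)%N = n).
Implicit Types (f : 'M[R]_(r, n) -> R) (G : 'M[R]_n) (o : R).

Lemma hodgeE G o f V : @hodge R n G o r s f V = (r`!%:R)^-1 *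
  \sum_I f (basis_rows R I *m invmx G) * (o * Num.sqrt (\det G) * vdet (basis_rows R I) V).
Proof.
by congr (_ * _); apply: eq_bigr => I _; rewrite -rowsubE.
Qed.

Lemma hodgeZ G o c f V :
  @hodge R n G o r s (fun W => c * f W) V = c * hodge G o f V.
Proof.
rewrite !hodgeE [RHS]mulrCA; congr (_ * _).
by rewrite big_distrr /=; apply: eq_bigr => I _; rewrite -!mulrA.
Qed.

Lemma hodge_alternating G o f : alternating_form (@hodge R n G o r s f).
Proof.
rewrite (_ : hodge G o f = fun V => (r`!%:R)^-1 * \sum_I
    (f (basis_rows R I *m invmx G) * (o * Num.sqrt (\det G))) * vdet (basis_rows R I) V).
  apply/alternating_scale/alternating_sum => I; apply: alternating_scale.
  exact: vdet_altr.
apply/funext => V; rewrite hodgeE; congr (_ * _).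
by apply: eq_bigr => I _; rewrite !mulrA.
Qed.

End HodgeStar.

Lemma natfact_neq0 (R : realType) k : k`!%:R != 0 :> R.
Proof. by rewrite pnatr_eq0 -lt0n fact_gt0. Qed.

Section HodgeStarStar.
Context (R : realType) (r s n : nat) (rsn : (r + s)%N = n).
Implicit Types (f : 'M[R]_(r, n) -> R) (G : 'M[R]_n) (o : R).

(** The constant [e] is chosen before [G], [o] and [f]: it is the block swap sign. The two sums over
    index tuples give s! and r!, which cancel the normalising factors, and the volume factors cancel
    against the raised indices. *)
Lemma hodgeK : exists2 e : R, e != 0 &
  forall G o f, posdef G -> o = 1 \/ o = -1 -> alternating_form f ->
    forall A, @hodge R n G o s r (@hodge R n G o r s f) A = e * f A.
Proof.
have [e e0 swp] := @vdet_swap R r s n rsn; exists e => // G o f Gpd o1 fa A.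
have /alternating_formP[fl _] := fa.
have o2 : o * o = 1 by case: o1 => ->; rewrite ?mulr1 ?mulrNN ?mulr1.
have detG := posdef_det_gt0 Gpd.
set c := o * Num.sqrt (\det G).
have c2 : c * c = \det G.
  by rewrite /c mulrACA o2 mul1r -expr2 sqr_sqrtr// ltW.
have cE : o * Num.sqrt (\det G) = c by [].
clearbody c.
(* Once [invmx G] is moved off [f], it acts on both blocks of the volume and comes out as 1 / \det
   G; the second star contributes another [c], and [c * c] is \det G. *)
have inner (K : {ffun 'I_s -> 'I_n}) :
    @hodge R n G o r s f (basis_rows R K *m invmx G) =
    (r`!%:R)^-1 * (c / \det G) *
    \sum_I f (basis_rows R I) * vdet (basis_rows R I) (basis_rows R K).
  have /alternating_formP[dl _] := vdet_altl rsn (basis_rows R K *m invmx G).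
  rewrite hodgeE cE -mulrA; congr (_ * _).
  under eq_bigr do rewrite mulrCA.
  rewrite -big_distrr /= (mlinear_contract (invmx G) fl dl) /= -mulrA; congr (_ * _).
  rewrite trmx_inv Gpd.1 big_distrr /=; apply: eq_bigr => I _.
  by rewrite vdetM// det_inv mulrA mulrC.
rewrite hodgeE cE.
under eq_bigr do rewrite inner swp.
transitivity ((s`!%:R)^-1 * (r`!%:R)^-1 * e * \sum_(K : {ffun 'I_s -> 'I_n}) \sum_I f (basis_rows R I) *
   (vdet (basis_rows R I) (basis_rows R K) * vdet A (basis_rows R K))).
  rewrite -!mulrA; congr (_ * _); rewrite !big_distrr/=; apply: eq_bigr => K _.
  under [in RHS]eq_bigr do rewrite mulrA.
  rewrite -big_distrl /=; set S := \sum_I _.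
  rewrite [LHS](_ : _ =
    (c * c / \det G) * ((r`!%:R)^-1 * (e * (S * vdet A (basis_rows R K))))); last by ring.
  by rewrite c2 mulfV ?gt_eqF// mul1r.
rewrite exchange_big /=.
under eq_bigr do rewrite -big_distrr /= (sum_vdet_basis rsn) mulrCA.
rewrite -big_distrr /= sum_alternating_det//.
have := natfact_neq0 R r; have := natfact_neq0 R s; set x := s`!%:R; set y := r`!%:R.
by move=> x0 y0; field; rewrite x0 y0.
Qed.

(** This makes the star of a form a form again. The volume contributes 1 / \det J and the square
    root contributes the absolute value of \det J; the sign relating the orientations is exactly
    what makes these cancel. *)
Lemma hodge_natural G G' o o' (J : 'M[R]_n) f f' : posdef G ->
  G = J *m G' *m J^T -> o = Num.sg (\det J) * o' ->
  alternating_form f' -> (forall V, f V = f' (V *m J)) ->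
  forall V : 'M[R]_(s, n), hodge G o f V = hodge G' o' f' (V *m J).
Proof.
move=> Gpd GJ oE f'a fE V; have /alternating_formP[f'l _] := f'a.
have detG0 := posdef_det_neq0 Gpd.
have /and3P[dJ dG' dJT] : [&& \det J != 0, \det G' != 0 & \det (J^T) != 0].
  by move: detG0; rewrite GJ !det_mulmx !mulf_eq0 !negb_or -andbA.
have uJ : J \in unitmx by rewrite unitmxE unitfE.
have uG' : G' \in unitmx by rewrite unitmxE unitfE.
have uJT : J^T \in unitmx by rewrite unitmx_tr.
(* Raising indices and then pushing forward by [J] is raising them in the target chart after J^-T;
   the latter is then contracted onto the volume as J^-1. *)
have GJinv : invmx G *m J = invmx J^T *m invmx G'.
  have GinvE : invmx G = invmx (J^T) *m invmx G' *m invmx J.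
    have uG : G \in unitmx by apply: posdef_unit.
    apply: (can_inj (mulKmx uG)); rewrite mulmxV// GJ.
    by rewrite !mulmxA mulmxK// mulmxK// mulmxV.
  by rewrite GinvE mulmxKV.
rewrite !hodgeE; congr (_ * _).
under eq_bigr do rewrite fE -mulmxA GJinv mulmxA.
have /alternating_formP[dl _] := vdet_altl rsn V.
under eq_bigr do rewrite mulrCA.
rewrite -big_distrr /= (mlinear_contract _ (mlinear_comp (invmx G') f'l) dl).
rewrite trmx_inv trmxK big_distrr /=; apply: eq_bigr => I _.
have -> : vdet (basis_rows R I *m invmx J) V =
    vdet (basis_rows R I) (V *m J) * (\det J)^-1.
  by rewrite -det_inv -vdetM// mulmxK.
have -> : Num.sqrt (\det G) = `|\det J| * Num.sqrt (\det G').
  rewrite GJ !det_mulmx det_tr mulrAC -expr2 sqrtrM ?sqr_ge0//.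
  by rewrite sqrtr_sqr.
rewrite {}oE; set x := f' _; set v := vdet _ _.
have -> : Num.sg (\det J) * o' * (`|\det J| * Num.sqrt (\det G')) * (x * (v / \det J))
  = (Num.sg (\det J) * `|\det J| / \det J) * (x * (o' * Num.sqrt (\det G') * v)) by ring.
by rewrite -numEsg mulfV// mul1r.
Qed.
End HodgeStarStar.

Section HodgeInverse.
Context (R : realType) (r s n : nat) (rsn : (r + s)%N = n).
Context (G : 'M[R]_n) (o : R) (Gpd : posdef G) (o1 : o = 1 \/ o = -1).

Lemma hodge_inj (f1 f2 : 'M[R]_(r, n) -> R) :
  alternating_form f1 -> alternating_form f2 ->
  @hodge R n G o r s f1 = hodge G o f2 -> f1 = f2.
Proof.
move=> f1a f2a e; have [c c0 K] := hodgeK R rsn.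
by apply/funext => A; apply: (mulfI c0); rewrite -!(K G o)// e.
Qed.

(** The choice made by [xget] is harmless here: [f] is a preimage, and the star is injective on
    alternating forms. *)
Lemma hodge_inv_hodge (f : 'M[R]_(r, n) -> R) :
  alternating_form f -> hodge_inv G o (@hodge R n G o r s f) = f.
Proof.
move=> fa; rewrite /hodge_inv.
case: xgetP => [f' _ [f'a f'E]|/(_ f)/=]; first exact: hodge_inj.
by case.
Qed.

(** Zero is also the default of [hodge_inv], so [h] must first be shown to be a star. The double
    star formula does it: [h] is the star of its own star divided by the constant. *)
Lemma hodge_inv_eq0 (h : 'M[R]_(s, n) -> R) :
  alternating_form h -> @hodge_inv R n G o r s h = (fun=> 0) -> h = (fun=> 0).
Proof.
move=> ha; have srn : (s + r)%N = n by rewrite addnC.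
have [c c0 K] := hodgeK R srn.
have hE : h = @hodge R n G o r s (fun V => c^-1 * @hodge R n G o s r h V).
  by apply/funext => V; rewrite hodgeZ K// mulKf.
rewrite hE hodge_inv_hodge.
  by move=> ->; apply/funext => V; rewrite hodgeE big1 ?mulr0// => I _; rewrite mul0r.
exact/alternating_scale/hodge_alternating.
Qed.
End HodgeInverse.

(** * Calculus of smooth functions *)

Section DifferentiableEps.
Context (R : realType) (V W : normedModType R).
Implicit Types f g : V -> W.

Lemma differentiable_eps f (L : {linear V -> W}) x : continuous L ->
  (forall e, 0 < e -> \forall h \near (0 : V), `|f (h + x) - f x - L h| <= e * `|h|) ->
  differentiable f x /\ 'd f x = L :> (V -> W).
Proof.
move=> Lc fL.
have E : f \o shift x = cst (f x) + L +o_ (0 : V) id.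
  apply/eqaddoP => e e0; have := fL e e0; apply: filterS => h /=.
  by rewrite opprD addrA.
have dE := diff_unique Lc E.
by split=> //; apply/diff_locallyP; rewrite dE.
Qed.

Lemma differentiable_near f g x : {near x, f =1 g} ->
  differentiable f x -> differentiable g x.
Proof.
move=> fg df; apply: (@differentiable_eps g ('d f x) x _ _).1.
  exact: diff_continuous.
move=> e e0; have /diff_locallyP[_ /eqaddoP/(_ e e0)] := df.
have fg0 : \forall h \near (0 : V), f (h + x) = g (h + x).
  by move: fg; rewrite (near_shift 0); apply: filterS => h /=; rewrite subr0.
apply: filterS2 fg0 => h fgh; rewrite -fgh -(nbhs_singleton fg).
by rewrite -[_ - _ - _]addrA -opprD.
Qed.

End DifferentiableEps.

Section ClassC.
Context (R : realType) (V W : normedModType R).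
Implicit Types (f g : V -> W) (A B : set V).

Lemma near_join_eq f g x : {near x, f =1 g} ->
  \forall y \near (x : V), \forall z \near (y : V), f z = g z.
Proof. exact: near_join. Qed.

Lemma class_C_near m A f g : (forall x, A x -> {near x, f =1 g}) ->
  class_C m A f -> class_C m A g.
Proof.
elim: m f g => [|m IH] f g fg /=.
  move=> fc x Ax; have fx : f x = g x := nbhs_singleton (fg x Ax).
  rewrite /prop_for /continuous_at -fx.
  by apply: cvg_trans (fc x Ax); apply: near_eq_cvg; apply: filterS (fg x Ax) => y ->.
move=> [fd fD]; split=> [x Ax|v]; first exact: differentiable_near (fg x Ax) (fd x Ax).
apply: IH (fD v) => x Ax; have := near_join_eq (fg x Ax).
by apply: filterS => y; exact: near_eq_derive.
Qed.

(** Derivatives are those of the ambient space, never of a restriction to [A], so the condition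
    splits over the points. Smoothness can therefore be checked with a different local expression at
    each point. *)
Lemma class_C_pointwise m A f :
  class_C m A f <-> forall x, A x -> class_C m [set x] f.
Proof.
elim: m f => [|m IH] f /=.
  by split=> [fc x Ax _ ->|fc x Ax]; [exact: fc|exact: (fc x Ax x erefl)].
split=> [[fd fD] x Ax|fD].
  by split=> [_ ->|v]; [exact: fd|exact: (IH _).1 (fD v) x Ax].
by split=> [x Ax|v]; [exact: (fD x Ax).1|apply/IH => x Ax; exact: (fD x Ax).2].
Qed.

Lemma smooth_near A f g : (forall x, A x -> {near x, f =1 g}) ->
  smooth_on A f -> smooth_on A g.
Proof. by move=> fg fs m; exact: class_C_near fg (fs m). Qed.

Lemma smooth_eq A f g : open A -> (forall x, A x -> f x = g x) ->
  smooth_on A f -> smooth_on A g.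
Proof.
move=> oA fg; apply: smooth_near => x Ax.
by apply: filterS (open_nbhs_nbhs (conj oA Ax)).
Qed.

Lemma smooth_subset A B f : A `<=` B -> smooth_on B f -> smooth_on A f.
Proof.
move=> AB fs m; apply/class_C_pointwise => x /AB; exact: (class_C_pointwise m B f).1 (fs m) x.
Qed.

Lemma smooth_pointwise A f : (forall x, A x -> smooth_on [set x] f) -> smooth_on A f.
Proof. by move=> fs m; apply/class_C_pointwise => x /fs. Qed.

Lemma smooth_differentiable A f x : smooth_on A f -> A x -> differentiable f x.
Proof. by move=> /(_ 1%N)[fd _]; exact: fd. Qed.

Lemma smooth_derive A f v : smooth_on A f -> smooth_on A ('D_v f : V -> W).
Proof. by move=> fs m; have [_ h] := fs m.+1; exact: h. Qed.

Lemma smooth_continuous A f x : smooth_on A f -> A x -> {for x, continuous f}.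
Proof. by move=> /(_ 0%N); exact. Qed.

(** Induction on the order over the whole class [P] at once. Openness of [A] upgrades equality on
    [A] to equality near each point, hence to equality of all derivatives. *)
Lemma smooth_coind A (P : (V -> W) -> Prop) : open A ->
  (forall f, P f -> (forall x, A x -> differentiable f x) /\
     forall v, exists2 g, P g & forall x, A x -> 'D_v f x = g x) ->
  forall f, P f -> smooth_on A f.
Proof.
move=> oA PA f Pf m; elim: m f Pf => [|m IH] f /PA[fd fD] /=.
  by move=> x Ax; exact/differentiable_continuous/fd.
split=> // v; have [g /IH gC Dg] := fD v; apply: class_C_near gC => x Ax.
by apply: filterS (open_nbhs_nbhs (conj oA Ax)) => y Ay; rewrite Dg.
Qed.

Lemma deriveEl f x (u v : V) (s t : R) : differentiable f x ->
  'D_(s *: u + t *: v) f x = s *: 'D_u f x + t *: 'D_v f x.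
Proof. by move=> fd; rewrite !deriveE// linearD !linearZ. Qed.
End ClassC.

(** * Directional derivatives and Jacobians with row vectors *)

Section RowVectors.
Context (R : realType).

Lemma derive_delta n (W : normedModType R) (f : 'rV[R]_n -> W) x v : differentiable f x ->
  'D_v f x = \sum_j v 0 j *: 'D_(delta_mx 0 j) f x.
Proof.
move=> fd; rewrite deriveE// {1}[v]row_sum_delta linear_sum.
by apply: eq_bigr => j _; rewrite linearZ deriveE.
Qed.

Lemma derive_comp n m (W : normedModType R) (p : 'rV[R]_n -> 'rV[R]_m)
    (f : 'rV[R]_m -> W) x v : differentiable p x -> differentiable f (p x) ->
  'D_v (f \o p) x = 'D_(v *m jacobian p x) f (p x).
Proof.
move=> pd fd; rewrite !deriveE//; last exact: differentiable_comp.
by rewrite diff_comp//= /jacobian mul_rV_lin1.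
Qed.

Lemma row_jacobian n m (p : 'rV[R]_n -> 'rV[R]_m) x i : differentiable p x ->
  row i (jacobian p x) = 'D_(delta_mx 0 i) p x.
Proof. by move=> pd; rewrite rowE deriveEjacobian. Qed.

Lemma jacobian_comp n m l (p : 'rV[R]_n -> 'rV[R]_m) (q : 'rV[R]_m -> 'rV[R]_l) x :
  differentiable p x -> differentiable q (p x) ->
  jacobian (q \o p) x = jacobian p x *m jacobian q (p x).
Proof.
move=> pd qd; have pqd : differentiable (q \o p) x by exact: differentiable_comp.
apply/row_matrixP => i; rewrite row_mul (row_jacobian i pqd) derive_comp//.
by rewrite -rowE deriveEjacobian.
Qed.

Lemma jacobian_near n m (p q : 'rV[R]_n -> 'rV[R]_m) x : differentiable p x ->
  {near x, p =1 q} -> jacobian p x = jacobian q x.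
Proof.
move=> pd pq; have qd : differentiable q x by exact: differentiable_near pq pd.
apply/row_matrixP => i.
exact: etrans (row_jacobian i pd)
  (etrans (near_eq_derive _ pq) (esym (row_jacobian i qd))).
Qed.

Lemma jacobian_id n (x : 'rV[R]_n) : jacobian id x = 1%:M.
Proof.
apply/row_matrixP => i; rewrite row_jacobian; last exact: (ex_diff (df := id)).
by rewrite derive_id rowE mulmx1.
Qed.

Lemma differentiable_coordf n (V : normedModType R) (p : V -> 'rV[R]_n) x j :
  differentiable p x -> differentiable (fun y => p y 0 j : R) x.
Proof.
move=> pd; have := @differentiable_comp _ _ _ _ p (fun N : 'rV[R]_n => N 0 j : R) x pd.
by apply; exact: differentiable_coord.
Qed.

Lemma derive_coord n (V : normedModType R) (p : V -> 'rV[R]_n) x v j :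
  differentiable p x -> 'D_v (fun y => p y 0 j : R) x = ('D_v p x) 0 j.
Proof. by move=> pd; rewrite derive_mx ?mxE//; exact: diff_derivable. Qed.

Lemma smooth_coord n (V : normedModType R) (A : set V) (p : V -> 'rV[R]_n) j :
  open A -> smooth_on A p -> smooth_on A (fun x => p x 0 j : R).
Proof.
move=> oA ps.
pose P (f : V -> R) := exists2 q : V -> 'rV[R]_n, smooth_on A q & f = fun x => q x 0 j.
apply: (@smooth_coind _ _ _ A P oA); last by exists p.
move=> f [q qs ->]; split=> [x Ax|v].
  by apply: differentiable_coordf; exact: smooth_differentiable qs Ax.
exists (fun x => ('D_v q x) 0 j); first by exists ('D_v q) => //; exact: smooth_derive.
by move=> x Ax; apply: derive_coord; exact: smooth_differentiable qs Ax.
Qed.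

Lemma jacobianE n m (p : 'rV[R]_n -> 'rV[R]_m) x i j : differentiable p x ->
  jacobian p x i j = 'D_(delta_mx 0 i) (fun y => p y 0 j : R) x.
Proof. by move=> pd; rewrite derive_coord// -row_jacobian// [RHS]mxE. Qed.

Lemma smooth_jacobian n m (A : set 'rV[R]_n) (p : 'rV[R]_n -> 'rV[R]_m) i j :
  open A -> smooth_on A p -> smooth_on A (fun x => jacobian p x i j : R).
Proof.
move=> oA ps.
apply: (@smooth_eq _ _ _ _ ('D_(delta_mx 0 i) (fun y => p y 0 j : R)) _ oA).
  by move=> x Ax; rewrite jacobianE//; exact: smooth_differentiable ps Ax.
exact/smooth_derive/smooth_coord.
Qed.
End RowVectors.

(** * Smoothness of algebraic expressions and compositions *)

Section SmoothClosure.
Context (R : realType) (V : normedModType R) (A : set V) (oA : open A).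
Implicit Types f g : V -> R.

(* The functions built from smooth ones by the operations below are closed
   under directional derivatives, so that one coinduction gives the smoothness
   of all these operations. *)
Inductive smooth_closure : (V -> R) -> Prop :=
| SC_cst c : smooth_closure (fun=> c)
| SC_smooth f : smooth_on A f -> smooth_closure f
| SC_add f g : smooth_closure f -> smooth_closure g ->
    smooth_closure (fun x => f x + g x)
| SC_mul f g : smooth_closure f -> smooth_closure g ->
    smooth_closure (fun x => f x * g x)
| SC_inv f : smooth_closure f -> (forall x, A x -> f x != 0) ->
    smooth_closure (fun x => (f x)^-1)
| SC_sqrt f : smooth_closure f -> (forall x, A x -> 0 < f x) ->
    smooth_closure (fun x => Num.sqrt (f x))
| SC_comp n (B : set 'rV[R]_n) (p : V -> 'rV[R]_n) h :
    smooth_on A p -> smooth_on B h -> (forall x, A x -> B (p x)) ->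
    smooth_closure (fun x => h (p x)).

Lemma SC_sum (I : Type) (r : seq I) (f : I -> V -> R) :
  (forall i, smooth_closure (f i)) -> smooth_closure (fun x => \sum_(i <- r) f i x).
Proof.
move=> fs; elim: r => [|i r IH].
  by rewrite (_ : (fun _ => _) = fun=> 0); [exact: SC_cst|apply/funext => x; rewrite big_nil].
rewrite (_ : (fun _ => _) = fun x => f i x + \sum_(i <- r) f i x); first exact: SC_add.
by apply/funext => x; rewrite big_cons.
Qed.

Lemma smooth_closureP f : smooth_closure f -> smooth_on A f.
Proof.
apply: (smooth_coind oA) => {}f.
elim=> {f} [c|f fs|f g fC [fd fD] gC [gd gD]|f g fC [fd fD] gC [gd gD]
  |f fC [fd fD] f0|f fC [fd fD] f0|n B p h ps hs pB].
- split=> [x _|v]; first exact: differentiable_cst.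
  by exists (fun=> 0); [exact: SC_cst|move=> x _; rewrite derive_cst].
- split=> [x|v]; first exact: smooth_differentiable.
  by exists ('D_v f) => //; exact/SC_smooth/smooth_derive.
- split=> [x Ax|v]; first by apply: differentiableD; [exact: fd|exact: gd].
  have [[f' f'C Df] [g' g'C Dg]] := (fD v, gD v).
  exists (fun x => f' x + g' x); first exact: SC_add.
  move=> x Ax; rewrite -Df// -Dg//.
  by apply: deriveD; apply: diff_derivable; [exact: fd|exact: gd].
- split=> [x Ax|v]; first by apply: differentiableM; [exact: fd|exact: gd].
  have [[f' f'C Df] [g' g'C Dg]] := (fD v, gD v).
  exists (fun x => f x * g' x + g x * f' x).
    by apply: SC_add; apply: SC_mul.
  move=> x Ax; rewrite -Df// -Dg//.
  by apply: deriveM; apply: diff_derivable; [exact: fd|exact: gd].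
- split=> [x Ax|v]; first by apply: differentiableV; [exact: fd|exact: f0].
  have [f' f'C Df] := fD v.
  exists (fun x => (-1) * ((f x)^-1 * (f x)^-1) * f' x).
    do 2![apply: SC_mul => //]; first exact: SC_cst.
    by apply: SC_mul; exact: SC_inv.
  move=> x Ax; rewrite -Df// mulN1r -invfM -expr2 -[RHS]/(_ *: _).
  by apply: deriveV; [exact: f0|apply: diff_derivable; exact: fd].
- have sd x : A x -> differentiable (Num.sqrt : R -> R) (f x).
    by move=> Ax; apply/derivable1_diffP; have [] := is_derive1_sqrt (f0 x Ax).
  split=> [x Ax|v].
    by apply: (differentiable_comp (g := Num.sqrt)); [exact: fd|exact: sd].
  have [f' f'C Df] := fD v.
  exists (fun x => 2^-1 * (Num.sqrt (f x) * (f x)^-1) * f' x).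
    do 2![apply: SC_mul => //]; first exact: SC_cst.
    apply: SC_mul; first exact: SC_sqrt.
    by apply: SC_inv => // x /f0/gt_eqF->.
  move=> x Ax; rewrite -Df//.
  rewrite deriveE; last by apply: (differentiable_comp (g := Num.sqrt)); [exact: fd|exact: sd].
  rewrite (@diff_comp _ _ _ _ f Num.sqrt); [|exact: fd|exact: sd].
  rewrite /= -(deriveE v (fd x Ax)).
  rewrite deriv1E; last by have [] := is_derive1_sqrt (f0 x Ax).
  rewrite derive1E derive_sqrt ?f0//= [LHS]mulrC; congr (_ * _).
  have s0 : Num.sqrt (f x) != 0 by rewrite gt_eqF// sqrtr_gt0 f0.
  by rewrite invfM -{3}[f x]sqr_sqrtr ?ltW ?f0//; field.
- have pd x : A x -> differentiable p x by exact: smooth_differentiable.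
  have hd x : A x -> differentiable h (p x).
    by move=> /pB; exact: smooth_differentiable.
  split=> [x Ax|v].
    by apply: (differentiable_comp (g := h)); [exact: pd|exact: hd].
  (* The direction ['D_v p x] varies with [x]; expanded in coordinates, each term is a product of a
     smooth coefficient and a fixed directional derivative of [h] composed with [p], which stays in
     the closure. *)
  exists (fun x => \sum_j ('D_v p x) 0 j * 'D_(delta_mx 0 j) h (p x)).
    apply: SC_sum => j; apply: SC_mul.
      exact: (SC_smooth (smooth_coord j oA (smooth_derive v ps))).
    exact: (SC_comp ps (smooth_derive _ hs) pB).
  move=> x Ax; rewrite -derive_delta; last exact: hd.
  have hpd : differentiable (h \o p) x by apply: differentiable_comp; [exact: pd|exact: hd].
  rewrite (deriveE ('D_v p x) (hd x Ax)) (deriveE v (pd x Ax)).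
  rewrite -[RHS]/(('d h (p x) \o 'd p x) v) -(diff_comp (pd x Ax) (hd x Ax)).
  exact: (deriveE v hpd).
Qed.

Lemma smooth_cst c : smooth_on A (fun=> c : R).
Proof. exact/smooth_closureP/SC_cst. Qed.

Lemma smoothD f g : smooth_on A f -> smooth_on A g -> smooth_on A (fun x => f x + g x).
Proof. by move=> fs gs; apply/smooth_closureP/SC_add; exact: SC_smooth. Qed.

Lemma smoothM f g : smooth_on A f -> smooth_on A g -> smooth_on A (fun x => f x * g x).
Proof. by move=> fs gs; apply/smooth_closureP/SC_mul; exact: SC_smooth. Qed.

Lemma smoothV f : smooth_on A f -> (forall x, A x -> f x != 0) ->
  smooth_on A (fun x => (f x)^-1).
Proof. by move=> fs f0; apply/smooth_closureP/SC_inv => //; exact: SC_smooth. Qed.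

Lemma smooth_sqrt f : smooth_on A f -> (forall x, A x -> 0 < f x) ->
  smooth_on A (fun x => Num.sqrt (f x)).
Proof. by move=> fs f0; apply/smooth_closureP/SC_sqrt => //; exact: SC_smooth. Qed.

Lemma smooth_comp n (B : set 'rV[R]_n) (p : V -> 'rV[R]_n) (h : 'rV[R]_n -> R) :
  smooth_on A p -> smooth_on B h -> (forall x, A x -> B (p x)) ->
  smooth_on A (fun x => h (p x)).
Proof. by move=> ps hs pB; exact/smooth_closureP/(SC_comp ps hs). Qed.

Lemma smooth_sum (I : Type) (r : seq I) (f : I -> V -> R) :
  (forall i, smooth_on A (f i)) -> smooth_on A (fun x => \sum_(i <- r) f i x).
Proof. by move=> fs; apply/smooth_closureP/SC_sum => i; exact: SC_smooth. Qed.

Lemma smooth_prod (I : Type) (r : seq I) (f : I -> V -> R) :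
  (forall i, smooth_on A (f i)) -> smooth_on A (fun x => \prod_(i <- r) f i x).
Proof.
move=> fs; elim: r => [|i r IH].
  by under eq_fun do rewrite big_nil; exact: smooth_cst.
by under eq_fun do rewrite big_cons; exact: smoothM.
Qed.

Lemma smooth_det k (M : V -> 'M[R]_k) :
  (forall a b, smooth_on A (fun x => M x a b)) -> smooth_on A (fun x => \det (M x)).
Proof.
move=> Ms; apply: smooth_sum => s; apply: smoothM; first exact: smooth_cst.
exact: smooth_prod.
Qed.

Lemma smooth_mulmx k l m (M : V -> 'M[R]_(k, l)) (N : V -> 'M[R]_(l, m)) :
  (forall a b, smooth_on A (fun x => M x a b)) ->
  (forall a b, smooth_on A (fun x => N x a b)) ->
  forall a b, smooth_on A (fun x => (M x *m N x) a b).
Proof.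
by move=> Ms Ns a b; under eq_fun do rewrite mxE; apply: smooth_sum => j; exact: smoothM.
Qed.

Lemma smooth_invmx k (M : V -> 'M[R]_k) :
  (forall a b, smooth_on A (fun x => M x a b)) -> (forall x, A x -> M x \in unitmx) ->
  forall a b, smooth_on A (fun x => invmx (M x) a b).
Proof.
move=> Ms Mu a b.
apply: (@smooth_eq _ _ _ _ (fun x => (\det (M x))^-1 *
   ((-1) ^+ (b + a) * \det (row' b (col' a (M x)))))) => //.
  by move=> x Ax; rewrite /invmx Mu// !mxE.
apply: smoothM.
  by apply: smoothV; [exact: smooth_det|move=> x /Mu; rewrite unitmxE unitfE].
apply: smoothM; first exact: smooth_cst.
by apply: smooth_det => i j; under eq_fun do rewrite !mxE; exact: Ms.
Qed.
End SmoothClosure.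

(** * Mean values and symmetry of second derivatives *)

Section MeanValue.
Context (R : realType).

Lemma line_is_derive (V W : normedModType R) (f : V -> W) (x v : V) (s : R) :
  differentiable f (x + s *: v) ->
  is_derive s 1 (fun t : R => f (x + t *: v)) ('D_v f (x + s *: v)).
Proof.
move=> fd.
have ad : is_diff s (fun t : R => x + t *: v) (fun t => t *: v).
  have E : (cst x : R -> V) + ( *:%R^~ v) = (fun t : R => x + t *: v) by [].
  by rewrite -E -[X in is_diff_def _ _ X]add0r; apply: is_diffD.
have add : differentiable (fun t : R => x + t *: v) s by [].
have cd : differentiable (f \o (fun t : R => x + t *: v)) s by exact: differentiable_comp.
apply: DeriveDef; first exact/derivable1_diffP.
rewrite -[LHS]/('D_1 (f \o (fun t : R => x + t *: v)) s) (deriveE _ cd).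
by rewrite (diff_comp add fd) /= diff_val scale1r (deriveE _ fd).
Qed.

Lemma MVT01 (f df : R -> R) : (forall s : R, 0 <= s <= 1 -> is_derive s 1 f (df s)) ->
  exists2 s : R, 0 <= s <= 1 & f 1 - f 0 = df s.
Proof.
move=> fd; have [||s] := @MVT_segment R f df 0 1 ler01.
- by move=> s; rewrite in_itv/= => /andP[s0 s1]; apply: fd; rewrite !ltW.
- apply: derivable_within_continuous => s; rewrite in_itv/= => s01.
  by have [] := fd s s01.
- by rewrite in_itv/= subr0 mulr1 => s01 fE; exists s.
Qed.

Lemma MVT_line (V : normedModType R) (f : V -> R) (x v : V) :
  (forall s : R, 0 <= s <= 1 -> differentiable f (x + s *: v)) ->
  exists2 s : R, 0 <= s <= 1 & f (x + v) - f x = 'D_v f (x + s *: v).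
Proof.
move=> fd; have [s s01 E] := MVT01 (fun s s01 => line_is_derive (fd s s01)).
by exists s; rewrite // -E scale1r scale0r addr0.
Qed.

Lemma deriveZ_dir (V W : normedModType R) (f : V -> W) (x v : V) (s : R) :
  differentiable f x -> 'D_(s *: v) f x = s *: 'D_v f x.
Proof. by move=> fd; rewrite !deriveE// linearZ. Qed.

Lemma derive2Z (V : normedModType R) (A : set V) (f : V -> R) x u v (s t : R) :
  open A -> smooth_on A f -> A x ->
  'D_(s *: u) ('D_(t *: v) f) x = s * t * 'D_u ('D_v f) x.
Proof.
move=> oA fs Ax; rewrite deriveZ_dir; last first.
  exact: smooth_differentiable (smooth_derive _ fs) Ax.
rewrite -mulrA; congr (_ * _).
transitivity ('D_u (t *: ('D_v f : V -> R)) x).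
  apply: near_eq_derive; apply: filterS (open_nbhs_nbhs (conj oA Ax)) => y Ay.
  by rewrite deriveZ_dir//; exact: smooth_differentiable fs Ay.
rewrite deriveZ//; apply: diff_derivable.
exact: smooth_differentiable (smooth_derive _ fs) Ax.
Qed.

(** The mean value theorem twice: along [u] for the difference of [f] on two parallel segments, then
    along [v] for the resulting derivative ['D_u f]. *)
Lemma second_difference (V : normedModType R) (A : set V) (f : V -> R) x u v :
  smooth_on A f ->
  (forall s t : R, 0 <= s <= 1 -> 0 <= t <= 1 -> A (x + s *: u + t *: v)) ->
  exists s t : R, [/\ 0 <= s <= 1, 0 <= t <= 1 &
    f (x + u + v) - f (x + u) - (f (x + v) - f x) = 'D_v ('D_u f) (x + s *: u + t *: v)].
Proof.
move=> fs inA.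
have I0 : 0 <= (0 : R) <= 1 by rewrite lexx ler01.
have I1 : 0 <= (1 : R) <= 1 by rewrite lexx ler01.
have fd s t : 0 <= s <= 1 -> 0 <= t <= 1 -> differentiable f (x + s *: u + t *: v).
  by move=> s1 t1; apply: smooth_differentiable fs _; exact: inA.
have fd0 s : 0 <= s <= 1 -> differentiable f (x + s *: u).
  by move=> s01; have := fd s 0 s01 I0; rewrite scale0r addr0.
have fd1 s : 0 <= s <= 1 -> differentiable f (x + v + s *: u).
  by move=> s01; rewrite addrAC; have := fd s 1 s01 I1; rewrite scale1r.
have [s s01 E] := @MVT01 (fun s : R => f (x + v + s *: u) - f (x + s *: u))
  (fun s => 'D_u f (x + v + s *: u) - 'D_u f (x + s *: u)) (fun s s01 =>
     is_deriveB (line_is_derive (fd1 s s01)) (line_is_derive (fd0 s s01))).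
have [t t01 E'] := @MVT_line _ ('D_u f) (x + s *: u) v (fun t t01 =>
  smooth_differentiable (smooth_derive u fs) (inA s t s01 t01)).
exists s, t; split => //; rewrite -E' [x + s *: u + v]addrAC -E.
by rewrite !scale1r !scale0r !addr0 [x + v + u]addrAC !opprB; ring.
Qed.

Lemma close_eq (e p q a b : R) : `|p - a| < e / 2 -> `|q - b| < e / 2 -> p = q ->
  `|a - b| <= e.
Proof.
move=> pa qb pq; rewrite -(subrKA p) (le_trans (ler_normD _ _))//.
by rewrite [e]splitr lerD// ltW// ?pq// distrC -?pq.
Qed.

(** The second difference over a small parallelogram is symmetric in the two directions; evaluated
    in both orders it gives the two mixed derivatives at nearby points, and these derivatives are
    continuous. *)
Lemma derive_sym (V : normedModType R) (A : set V) (f : V -> R) x u v :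
  open A -> smooth_on A f -> A x -> 'D_u ('D_v f) x = 'D_v ('D_u f) x.
Proof.
move=> oA fs Ax; apply/eqP; rewrite -subr_eq0 -normr_le0; apply/ler_addgt0Pr => e e0.
rewrite add0r.
have cts w1 w2 : {for x, continuous ('D_w1 ('D_w2 f) : V -> R)}.
  by apply: smooth_continuous Ax; do 2!apply: smooth_derive.
have e2 : 0 < e / 2 by rewrite divr_gt0.
have /(cvgr_distC_lt _) /(_ _ e2) N1 := cts u v.
have /(cvgr_distC_lt _) /(_ _ e2) N2 := cts v u.
have /nbhs_ballP[d /= d0 dA] : nbhs x (A `&` [set y |
    `|'D_u ('D_v f) y - 'D_u ('D_v f) x| < e / 2 /\
    `|'D_v ('D_u f) y - 'D_v ('D_u f) x| < e / 2]).
  apply: filterI; first exact: open_nbhs_nbhs.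
  by apply: filterS2 N1 N2 => y h1 h2; exact: (conj h1 h2).
(* Scaled by [s], the whole parallelogram lies in the ball of radius [d]; the added 1 keeps the
   denominator positive when both vectors vanish. *)
pose s := d / (`|u| + `|v| + 1).
have uv0 : 0 < `|u| + `|v| + 1 by rewrite ltr_wpDl// addr_ge0.
have s0 : 0 < s by rewrite divr_gt0.
have sd : s * (`|u| + `|v|) < d.
  by rewrite /s mulrAC ltr_pdivrMr// ltr_pM2l// ltrDl.
clearbody s.
have near_x (a b : R) : 0 <= a <= 1 -> 0 <= b <= 1 ->
    ball x d (x + a *: (s *: u) + b *: (s *: v)).
  move=> /andP[a0 a1] /andP[b0 b1]; rewrite -ball_normE /ball_ /=.
  rewrite -addrA opprD addrA subrr add0r normrN.
  rewrite (le_lt_trans (ler_normD _ _))// !normrZ !(ger0_norm a0) !(ger0_norm b0) (gtr0_norm s0).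
  by apply: le_lt_trans sd; rewrite mulrDr lerD// ler_piMl// mulr_ge0// ltW.
have near_x' (a b : R) : 0 <= a <= 1 -> 0 <= b <= 1 ->
    A (x + a *: (s *: v) + b *: (s *: u)).
  by move=> a01 b01; rewrite addrAC; exact: (dA _ (near_x b a b01 a01)).1.
have [a [b [a01 b01 E1]]] := second_difference fs near_x'.
have [a' [b' [a'01 b'01 E2]]] := @second_difference _ A f x (s *: u) (s *: v) fs
  (fun a b a01 b01 => (dA _ (near_x a b a01 b01)).1).
have := dA _ (near_x b a b01 a01); rewrite addrAC => -[Ap [p1 _]].
have [Aq [_ q2]] := dA _ (near_x a' b' a'01 b'01).
(* Both expressions of the second difference carry the factor [s * s] from the rescaled directions,
   which is then cancelled. *)
have pq := etrans (esym (derive2Z u v s s oA fs Ap)) (etrans (esym E1) (etrans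
  (_ : _ = f (x + s *: u + s *: v) - f (x + s *: u) - (f (x + s *: v) - f x))
  (etrans E2 (derive2Z v u s s oA fs Aq)))).
have {}pq := mulfI (_ : s * s != 0) (pq _).
have ss0 : s * s != 0 by rewrite mulf_neq0 ?gt_eqF.
have {ss0}pq := pq ss0 (ltac:(rewrite [x + s *: v + _]addrAC; ring)).
exact: close_eq p1 q2 pq.
Qed.
End MeanValue.

(** * Second order Taylor bounds *)

Section RowCalculus.
Context (R : realType) (n : nat).
Implicit Types (A : set 'rV[R]_n) (f : 'rV[R]_n -> R).

Lemma smooth_id A : open A -> smooth_on A (id : 'rV[R]_n -> 'rV[R]_n).
Proof.
move=> oA.
pose P (f : 'rV[R]_n -> 'rV[R]_n) := f = id \/ exists c, f = cst c.
apply: (@smooth_coind _ _ _ A P oA); last by left.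
move=> f [->|[c ->]]; split=> [x _|v].
- exact: (ex_diff (df := id)).
- by exists (cst v); [right; exists v|move=> x _; exact: derive_id].
- exact: differentiable_cst.
- by exists (cst 0); [right; exists 0|move=> x _; exact: derive_cst].
Qed.

Lemma smooth_locally_const A f : open A ->
  (forall x, A x -> \forall y \near x, f y = f x) -> smooth_on A f.
Proof.
move=> oA fc; apply: smooth_pointwise => x Ax.
apply: (@smooth_near _ _ _ _ (cst (f x))).
  by move=> _ ->; apply: filterS (fc x Ax) => y ->.
apply: smooth_subset (smooth_cst openT (f x)) => //.
Qed.

Lemma differentiable_eps_row f (a : 'I_n -> R) x :
  (forall e, 0 < e -> \forall h \near (0 : 'rV[R]_n),
     `|f (h + x) - f x - \sum_j h 0 j * a j| <= e * `|h|) ->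
  differentiable f x /\ forall v, 'D_v f x = \sum_j v 0 j * a j.
Proof.
move=> fa; pose L (h : 'rV[R]_n) : R := \sum_j h 0 j * a j.
have Llin : linear L.
  move=> s u v; rewrite /L scaler_sumr -big_split; apply: eq_bigr => j _.
  by rewrite !mxE mulrDl -mulrA.
pose Lm : {linear 'rV[R]_n -> R} :=
  HB.pack L (GRing.isLinear.Build R 'rV[R]_n R *:%R L Llin).
have Lc : continuous Lm.
  move=> y; apply: (@smooth_continuous _ _ _ setT) => //.
  apply: smooth_sum => [|j]; first exact: openT.
  apply: smoothM; [exact: openT| |exact: smooth_cst openT (a j)].
  by apply: smooth_coord; [exact: openT|apply: smooth_id; exact: openT].
have [fd dE] := differentiable_eps Lc fa.
by split=> // v; rewrite deriveE// dE.
Qed.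

Lemma row_entry_le (v : 'rV[R]_n) j : `|v 0 j| <= `|v|.
Proof.
rewrite [in leRHS]/Num.Def.normr/= mx_normrE.
by apply: le_trans (le_bigmax _ (fun ij : 'I_1 * 'I_n => `|v ij.1 ij.2|) (0, j)).
Qed.

Lemma derive2_bound A f x (u v : 'rV[R]_n) (M : R) : open A -> smooth_on A f -> A x ->
  (forall i j, `|'D_(delta_mx 0 i) ('D_(delta_mx 0 j) f) x| <= M) ->
  `|'D_u ('D_v f) x| <= (n * n)%:R * M * (`|u| * `|v|).
Proof.
move=> oA fs Ax fM.
have E : 'D_u ('D_v f) x =
    \sum_i \sum_j u 0 i * (v 0 j * 'D_(delta_mx 0 i) ('D_(delta_mx 0 j) f) x).
  apply: etrans (derive_delta _ (smooth_differentiable (smooth_derive v fs) Ax)) _.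
  apply: eq_bigr => i _; rewrite -mulr_sumr; congr (_ * _).
  apply: (@etrans _ _ ('D_(delta_mx 0 i)
     (\sum_j (v 0 j *: 'D_(delta_mx 0 j) f : 'rV[R]_n -> R)) x)).
    apply: near_eq_derive; apply: filterS (open_nbhs_nbhs (conj oA Ax)) => y Ay.
    apply: etrans (derive_delta _ (smooth_differentiable fs Ay)) _.
    by rewrite fct_sumE.
  have dd j : derivable (v 0 j *: 'D_(delta_mx 0 j) f : 'rV[R]_n -> R) x (delta_mx 0 i).
    apply/derivableZ/diff_derivable.
    exact: smooth_differentiable (smooth_derive _ fs) Ax.
  apply: etrans (derive_sum dd) _; apply: eq_bigr => j _.
  apply: deriveZ; apply/diff_derivable.
  exact: smooth_differentiable (smooth_derive _ fs) Ax.
rewrite E; apply: le_trans (ler_norm_sum _ _ _) _.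
apply: (@le_trans _ _ (\sum_(i < n) \sum_(j < n) (M * (`|u| * `|v|)))); last first.
  by rewrite !sumr_const !card_ord -mulrnA -[leLHS]mulr_natl mulrA.
apply: ler_sum => i _; apply: le_trans (ler_norm_sum _ _ _) _.
apply: ler_sum => j _; have := fM i j; set D := 'D_ _ _ _ => DM.
rewrite !normrM mulrA [M * _]mulrC ler_pM ?mulr_ge0//.
by rewrite ler_pM// row_entry_le.
Qed.

(** Two applications of the mean value theorem bound the remainder by a second derivative on the
    segment. The factor n^2 counts the second partials, each entry of a vector being at most its sup
    norm. *)
Lemma second_order_bound A f y k (M : R) : 0 <= M -> open A -> smooth_on A f ->
  (forall s : R, 0 <= s <= 1 -> A (y + s *: k) /\
     forall i j, `|'D_(delta_mx 0 i) ('D_(delta_mx 0 j) f) (y + s *: k)| <= M) ->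
  `|f (y + k) - f y - 'D_k f y| <= (n * n)%:R * M * (`|k| * `|k|).
Proof.
move=> M0 oA fs yk.
have fd (s : R) : 0 <= s <= 1 -> differentiable f (y + s *: k).
  by move=> /yk[Ay _]; exact: smooth_differentiable fs Ay.
have [s /andP[s0 s1] ->] := MVT_line fd.
have st (t : R) : 0 <= t <= 1 -> 0 <= t * s <= 1.
  by move=> /andP[t0 t1]; rewrite mulr_ge0//= mulr_ile1.
have Dd (t : R) : 0 <= t <= 1 -> differentiable ('D_k f) (y + t *: (s *: k)).
  rewrite scalerA => /st/yk[Ay _].
  exact: smooth_differentiable (smooth_derive _ fs) Ay.
have [t t01 ->] := MVT_line Dd; rewrite scalerA.
have [Ay DM] := yk _ (st t t01).
apply: le_trans (derive2_bound (s *: k) k oA fs Ay DM) _.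
apply: ler_wpM2l.
  exact: mulr_ge0.
by rewrite normrZ ger0_norm// -mulrA ler_piMl// mulr_ge0.
Qed.
End RowCalculus.

(** * Integrals along rays *)

Section RayIntegral.
Context (R : realType) (n : nat) (A : set 'rV[R]_n) (c : 'rV[R]_n).
Hypothesis oA : open A.
(** Star-shapedness about [c] in a locally uniform form: one compact subset of [A] holds the
    segments to all points near [x], which gives bounds on derivatives uniform in the integration
    variable. *)
Hypothesis starA : forall x, A x -> exists2 K, compact K & K `<=` A /\
  \forall y \near x, forall t : R, 0 <= t <= 1 -> K (c + t *: (y - c)).
Implicit Types (f : 'rV[R]_n -> R).

Local Notation mu := (@lebesgue_measure R).

(** The weight makes the family stable under differentiation: the chain rule brings out one factor
    [t], raising [m] by one. *)
Definition ray_int m f (x : 'rV[R]_n) : R :=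
  \int[mu]_(t in `[0, 1]) (t ^+ m * f (c + t *: (x - c))).

Lemma ray_in x (t : R) : A x -> 0 <= t <= 1 -> A (c + t *: (x - c)).
Proof. by move=> /starA[K _ [KA /nbhs_singleton xK]] /xK/KA. Qed.

Lemma ray_is_derive m f x (t : R) : smooth_on A f -> A x -> 0 <= t <= 1 ->
  is_derive t 1 (fun t : R => t ^+ m * f (c + t *: (x - c)))
    (t ^+ m * 'D_(x - c) f (c + t *: (x - c)) + f (c + t *: (x - c)) * (m%:R * t ^+ m.-1)).
Proof.
move=> fs Ax t01.
have fd : differentiable f (c + t *: (x - c)).
  by apply: smooth_differentiable fs _; exact: ray_in.
have Hf := line_is_derive fd.
have Hm : is_derive t 1 (fun t : R => t ^+ m) (m%:R * t ^+ m.-1).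
  apply: DeriveDef; first exact: exprn_derivable.
  by rewrite exp_derive; exact: mulr1.
exact: (is_deriveM Hm Hf).
Qed.

Lemma ray_integrable m f x : smooth_on A f -> A x ->
  mu.-integrable `[0, 1] (EFin \o (fun t : R => t ^+ m * f (c + t *: (x - c)))).
Proof.
move=> fs Ax; apply: continuous_compact_integrable; first exact: segment_compact.
apply: derivable_within_continuous => t; rewrite in_itv/= => t01.
by have [] := ray_is_derive m fs Ax t01.
Qed.

Lemma Rintegral01_le (F : R -> R) (C : R) : mu.-integrable `[0, 1] (EFin \o F) ->
  (forall t, 0 <= t <= 1 -> `|F t| <= C) -> `|\int[mu]_(t in `[0, 1]) F t| <= C.
Proof.
move=> Fi FC; apply: le_trans (le_normr_Rintegral _ Fi) _ => //.
have -> : C = \int[mu]_(t in `[0, 1]) C.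
  by rewrite Rintegral_cst//= lebesgue_measure_itv/= lte_fin ltr01 oppr0 adde0 mulr1.
apply: le_Rintegral => //.
- exact: integrable_norm.
- apply: continuous_compact_integrable; first exact: segment_compact.
  by apply: continuous_subspaceT => ?; exact: cvg_cst.
Qed.

Lemma integrable01Z (a : R) (F : R -> R) : mu.-integrable `[0, 1] (EFin \o F) ->
  mu.-integrable `[0, 1] (EFin \o (fun t => a * F t)).
Proof.
by move=> Fi; have := @integrableZl _ _ _ mu `[0, 1]%classic (measurable_itv _) a _ Fi.
Qed.

Lemma integrable01D (F G : R -> R) : mu.-integrable `[0, 1] (EFin \o F) ->
  mu.-integrable `[0, 1] (EFin \o G) ->
  mu.-integrable `[0, 1] (EFin \o (fun t => F t + G t)).
Proof.
move=> Fi Gi.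
by have := @integrableD _ _ _ mu `[0, 1]%classic (measurable_itv _) _ _ Fi Gi.
Qed.

Lemma integrable01B (F G : R -> R) : mu.-integrable `[0, 1] (EFin \o F) ->
  mu.-integrable `[0, 1] (EFin \o G) ->
  mu.-integrable `[0, 1] (EFin \o (fun t => F t - G t)).
Proof.
move=> Fi Gi.
by have := @integrableB _ _ _ mu `[0, 1]%classic (measurable_itv _) _ _ Fi Gi.
Qed.

Lemma Rintegral01_sum (I : Type) (r : seq I) (a : I -> R) (F : I -> R -> R) :
  (forall i, mu.-integrable `[0, 1] (EFin \o F i)) ->
  mu.-integrable `[0, 1] (EFin \o (fun t => \sum_(i <- r) a i * F i t)) /\
  \int[mu]_(t in `[0, 1]) (\sum_(i <- r) a i * F i t) =
  \sum_(i <- r) a i * \int[mu]_(t in `[0, 1]) F i t.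
Proof.
move=> Fi; elim: r => [|i r [IHi IH]].
  have -> : (fun t : R => \sum_(i <- [::]) a i * F i t) = fun=> 0.
    by apply/funext => t; rewrite big_nil.
  rewrite big_nil; split; first exact: integrable0.
  by rewrite Rintegral_cst//= mul0r.
have aFi : mu.-integrable `[0, 1] (EFin \o (fun t => a i * F i t)).
  exact/integrable01Z/Fi.
have -> : (fun t : R => \sum_(j <- i :: r) a j * F j t) =
    fun t => a i * F i t + \sum_(j <- r) a j * F j t.
  by apply/funext => t; rewrite big_cons.
rewrite big_cons -IH -RintegralZl// -RintegralD//; split=> //.
exact: integrable01D aFi IHi.
Qed.

Lemma ray_int_sum (I : Type) (r : seq I) (a : I -> R) (f : I -> 'rV[R]_n -> R) g m x :
  (forall i, smooth_on A (f i)) -> A x ->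
  (forall y, A y -> g y = \sum_(i <- r) a i * f i y) ->
  ray_int m g x = \sum_(i <- r) a i * ray_int m (f i) x.
Proof.
move=> fs Ax gE.
have [_ <-] := Rintegral01_sum r a (fun i => ray_integrable m (fs i) Ax).
apply: eq_Rintegral => t; rewrite inE/= in_itv/= => t01.
rewrite gE; last exact: ray_in.
by rewrite mulr_sumr; apply: eq_bigr => i _; rewrite mulrCA.
Qed.

Lemma compact_norm_bound (K : set 'rV[R]_n) (f : 'rV[R]_n -> R) : compact K ->
  (forall y, K y -> {for y, continuous f}) ->
  exists2 M, 0 <= M & forall y, K y -> `|f y| <= M.
Proof.
move=> cK fc.
have : compact (f @` K).
  by apply: continuous_compact => //; apply: continuous_in_subspaceT => y /set_mem/fc.
move=> /compact_bounded[M [_ MP]]; exists (`|M| + 1); first by rewrite addr_ge0.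
by move=> y Ky; apply: MP; [rewrite ltr_pwDr// ler_norm|exists y].
Qed.

(** Differentiation under the integral sign: the Taylor bound holds for every [t] with the same
    constant, so after integration the remainder is still quadratic in [h]. *)
Lemma ray_int_differentiable m f x : smooth_on A f -> A x ->
  differentiable (ray_int m f) x /\
  forall v, 'D_v (ray_int m f) x = \sum_j v 0 j * ray_int m.+1 ('D_(delta_mx 0 j) f) x.
Proof.
move=> fs Ax; apply: differentiable_eps_row => e e0.
have [K cK [KA xK]] := starA Ax.
have [M M0 KM] : exists2 M, 0 <= M & forall y, K y -> forall i j,
    `|'D_(delta_mx 0 i) ('D_(delta_mx 0 j) f) y| <= M.
  have /(_ _)/cid2 bnd (p : 'I_n * 'I_n) : exists2 M, 0 <= M & forall y, K y ->
      `|'D_(delta_mx 0 p.1) ('D_(delta_mx 0 p.2) f) y| <= M.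
    apply: compact_norm_bound => // y /KA.
    by apply: smooth_continuous; do 2!apply: smooth_derive.
  (* The sum of the bounds for the finitely many second partials dominates each of them. *)
  exists (\sum_p s2val (bnd p)); first by apply: sumr_ge0 => p _; case: (bnd p).
  move=> y Ky i j; apply: le_trans (s2valP' (bnd (i, j)) y Ky) _.
  by rewrite (bigD1 (i, j))//= lerDl sumr_ge0// => p _; case: (bnd p).
have /nbhs_ballP[d /= d0 dK] := xK.
pose C := (n * n)%:R * M.
have C0 : 0 <= C by rewrite mulr_ge0.
(* The first bound keeps the rays to the points between [x] and [h + x] inside [K]; the second turns
   the quadratic remainder into at most [e] times the norm of [h]. *)
pose d' := Num.min d (e / (C + 1)).
have d'0 : 0 < d' by rewrite lt_min d0 divr_gt0// ltr_wpDl.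
apply/nbhs_ballP; exists d' => //= h; rewrite -ball_normE /ball_ /= sub0r normrN.
rewrite lt_min => /andP[hd he].
have inK (s t : R) : 0 <= s <= 1 -> 0 <= t <= 1 -> K (c + t *: (s *: h + x - c)).
  move=> /andP[s0 s1]; apply: dK; rewrite -ball_normE /ball_ /= opprD addrCA subrr addr0 normrN.
  by rewrite normrZ ger0_norm// (le_lt_trans _ hd)// ler_piMl.
have Ahx : A (h + x).
  by have := KA _ (inK 1 1 _ _); rewrite !scale1r [c + _]addrC subrK; apply; rewrite lexx ler01.
have dfs j : smooth_on A ('D_(delta_mx 0 j) f) by exact: smooth_derive.
have [sumi <-] := Rintegral01_sum (index_enum 'I_n) (h 0)
  (fun j => ray_integrable m.+1 (dfs j) Ax).
have i1 := ray_integrable m fs Ahx; have i2 := ray_integrable m fs Ax.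
have i12 := integrable01B i1 i2.
have i3 := integrable01B i12 sumi.
rewrite /ray_int -RintegralB// -RintegralB//.
apply: (@le_trans _ _ (C * (`|h| * `|h|))); last first.
  rewrite mulrA ler_wpM2r//; move: he; rewrite ltr_pdivlMr ?ltr_wpDl// => he.
  by rewrite (le_trans _ (ltW he))// mulrC ler_wpM2l// lerDl.
apply: Rintegral01_le => // t /[dup] t01 /andP[t0 t1].
pose y := c + t *: (x - c).
have yk s : y + s *: (t *: h) = c + t *: (s *: h + x - c).
  rewrite /y -addrA; congr (_ + _); rewrite -addrA [in RHS]scalerDr addrC.
  by rewrite !scalerA mulrC.
have Ay : A y by exact: ray_in.
have seg (s : R) : 0 <= s <= 1 -> A (y + s *: (t *: h)) /\
    forall i j, `|'D_(delta_mx 0 i) ('D_(delta_mx 0 j) f) (y + s *: (t *: h))| <= M.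
  by move=> s01; rewrite yk; split; [exact/KA/inK|apply: KM; exact: inK].
have := second_order_bound M0 oA fs seg.
have -> : y + t *: h = c + t *: (h + x - c) by have := yk 1; rewrite !scale1r.
have -> : 'D_(t *: h) f y = t * \sum_j h 0 j * 'D_(delta_mx 0 j) f y.
  have fdy := smooth_differentiable fs Ay.
  apply: etrans (deriveZ_dir _ _ fdy) _; congr (_ * _).
  exact: (derive_delta _ fdy).
set D := \sum_j _; set a := f _; set b := f _.
move=> bound; rewrite (_ : _ - _ = t ^+ m * (a - b - t * D)); last first.
  rewrite !mulrBr; congr (_ - _); rewrite mulrA -exprSr /D mulr_sumr.
  by apply: eq_bigr => j _; rewrite mulrCA.
rewrite normrM ger0_norm ?exprn_ge0// -[leRHS]mul1r ler_pM ?exprn_ge0// ?exprn_ile1//.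
apply: le_trans bound _; rewrite -/C ler_wpM2l// normrZ ger0_norm//.
by apply: ler_pM; rewrite ?mulr_ge0// ler_piMl.
Qed.

Lemma ray_int_derive m f x v : smooth_on A f -> A x ->
  'D_v (ray_int m f) x = ray_int m.+1 ('D_v f) x.
Proof.
move=> fs Ax; apply: etrans ((ray_int_differentiable m fs Ax).2 v) _.
apply/esym/ray_int_sum => // [j|y Ay]; first exact: smooth_derive.
exact: derive_delta _ (smooth_differentiable fs Ay).
Qed.

(** Coinduction over all weights and all smooth integrands together, since a derivative changes
    both. *)
Lemma smooth_ray_int m f : smooth_on A f -> smooth_on A (ray_int m f).
Proof.
move=> fs.
pose P (F : 'rV[R]_n -> R) := exists m f, smooth_on A f /\ F = ray_int m f.
apply: (@smooth_coind _ _ _ A P oA); last by exists m, f.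
move=> F [{fs}m [{}f [fs ->]]]; split=> [x Ax|v].
  exact: (ray_int_differentiable m fs Ax).1.
exists (ray_int m.+1 ('D_v f)); last by move=> x; exact: ray_int_derive.
by exists m.+1, ('D_v f); split=> //; exact: smooth_derive.
Qed.

(* Integrates the derivative of t^(m+1) f(c + t (x - c)) over [0, 1]. *)
Lemma ray_int_euler m f x : smooth_on A f -> A x ->
  m.+1%:R * ray_int m f x + ray_int m.+1 ('D_(x - c) f) x = f x.
Proof.
move=> fs Ax; have dfs : smooth_on A ('D_(x - c) f) by exact: smooth_derive.
have i1 := ray_integrable m fs Ax; have i2 := ray_integrable m.+1 dfs Ax.
have i1' := integrable01Z m.+1%:R i1.
rewrite /ray_int -RintegralZl// -RintegralD//.
pose F (t : R) := t ^+ m.+1 * f (c + t *: (x - c)).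
have Fd (t : R) : 0 <= t <= 1 -> is_derive t 1 F
    (m.+1%:R * (t ^+ m * f (c + t *: (x - c))) + t ^+ m.+1 * 'D_(x - c) f (c + t *: (x - c))).
  move=> t01; have := ray_is_derive m.+1 fs Ax t01.
  by move=> H; apply: is_derive_eq H _; rewrite addrC /=; ring.
have Fc (t : R) : 0 <= t <= 1 -> {for t, continuous F}.
  by move=> /Fd[/derivable1_diffP Ft _]; exact: differentiable_continuous.
rewrite /Rintegral (@continuous_FTC2 _ _ F)//.
- by rewrite -EFinB /F /= scale1r [c + _]addrC subrK expr1n mul1r expr0n/= mul0r subr0.
- apply: derivable_within_continuous => t; rewrite in_itv/= => t01.
  have [d1 _] := ray_is_derive m fs Ax t01.
  have [d2 _] := ray_is_derive m.+1 dfs Ax t01.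
  have H := derivableD (@derivableZ _ _ _ _ m.+1%:R _ _ d1) d2; exact: H.
- split.
  + by move=> t; rewrite in_itv/= => /andP[t0 t1]; have [] := Fd t; rewrite ?ltW.
  + by apply: cvg_at_right_filter; apply: Fc; rewrite lexx ler01.
  + by apply: cvg_at_left_filter; apply: Fc; rewrite lexx ler01.
- move=> t; rewrite in_itv/= => /andP[t0 t1].
  by rewrite derive1E; have [] := Fd t; rewrite ?ltW.
Qed.
End RayIntegral.

(** * Forms on open subsets of R^n *)

Section LocalForms.
Context (R : realType) (n : nat).
Implicit Types (A B : set 'rV[R]_n) (p q : 'rV[R]_n -> 'rV[R]_n).

Definition local_form k := 'rV[R]_n -> 'M[R]_(k, n) -> R.

Definition form_on k A (w : local_form k) : Prop :=
  (forall x, A x -> alternating_form (w x)) /\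
  (forall V, smooth_on A (fun x => w x V : R)).

(** In a fixed chart this is [ext_deriv] up to unfolding, so facts about [dd] apply to [codiff] by
    conversion. *)
Definition dd k (w : local_form k) : local_form k.+1 := fun x =>
  asum (fun u W => 'D_u (fun y => w y W : R) x).

Definition pb k p (w : local_form k) : local_form k :=
  fun x V => w (p x) (V *m jacobian p x).

Lemma dd_near k (w1 w2 : local_form k) x : {near x, w1 =1 w2} -> dd w1 x = dd w2 x.
Proof.
move=> w12; apply/funext => V; apply: eq_bigr => a _; congr (_ * _).
by apply: near_eq_derive; apply: filterS w12 => y ->.
Qed.

Lemma derive_big_sum (I : Type) (r : seq I) (f : I -> 'rV[R]_n -> R) x u :
  (forall i, differentiable (f i) x) ->
  differentiable (fun y => \sum_(i <- r) f i y : R) x /\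
  'D_u (fun y => \sum_(i <- r) f i y : R) x = \sum_(i <- r) 'D_u (f i) x.
Proof.
move=> fd; elim: r => [|i r [IHd IH]].
  have -> : (fun y => \sum_(i <- [::]) f i y) = cst 0.
    by apply/funext => y; rewrite big_nil.
  by rewrite big_nil derive_cst; split=> //; exact: differentiable_cst.
have -> : (fun y => \sum_(j <- i :: r) f j y) = f i + (fun y => \sum_(j <- r) f j y).
  by apply/funext => y; rewrite big_cons.
split; first exact: differentiableD.
rewrite big_cons -IH; apply: deriveD; exact: diff_derivable.
Qed.

(** Smoothness of a form is assumed on constant vectors only; the expansion into components extends
    it to vectors that vary with the point. *)
Lemma smooth_eval k A (w : local_form k) (N : 'rV[R]_n -> 'M[R]_(k, n)) : open A ->
  form_on A w -> (forall a j, smooth_on A (fun x => N x a j : R)) ->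
  smooth_on A (fun x => w x (N x) : R).
Proof.
move=> oA [wa ws] Ns.
have sumS : smooth_on A (fun x =>
    \sum_(L : {ffun 'I_k -> 'I_n}) (\prod_a N x a (L a)) * w x (basis_rows R L) : R).
  apply: smooth_sum => // L; apply: smoothM => //.
  by apply: smooth_prod => // a; exact: Ns.
apply: smooth_eq sumS => // x /wa/alternating_formP[wl _].
by rewrite (mlinear_expand (N x) wl).
Qed.

Lemma form_on_pb k A B p (w : local_form k) : open A -> open B -> smooth_on A p ->
  (forall x, A x -> B (p x)) -> form_on B w -> form_on A (pb p w).
Proof.
move=> oA oB ps pB [wa ws]; split=> [x Ax|V]; first exact/alternating_comp/wa/pB.
apply: (@smooth_eval _ A (fun x => w (p x)) (fun x => V *m jacobian p x)) => //.
  split=> [x /pB/wa//|W]; exact: smooth_comp ps (ws W) pB.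
by apply: smooth_mulmx => // a b; [exact: smooth_cst|exact: smooth_jacobian].
Qed.

Lemma pb_comp k p q (w : local_form k) x :
  differentiable p x -> differentiable q (p x) -> pb p (pb q w) x = pb (q \o p) w x.
Proof.
by move=> pd qd; apply/funext => V; rewrite /pb jacobian_comp// mulmxA.
Qed.

Lemma alternating_derive k A (w : local_form k) x u : open A -> form_on A w -> A x ->
  alternating_form (fun W => 'D_u (fun y => w y W : R) x).
Proof.
move=> oA [wa ws] Ax; have nA := open_nbhs_nbhs (conj oA Ax).
have wd W : derivable (fun y => w y W : R) x u.
  by apply: diff_derivable; exact: smooth_differentiable (ws W) Ax.
apply/alternating_formP; split.
  move=> V b v1 v2 s t.
  apply: (@etrans _ _ ('D_u ((s *: (fun y => w y (set_row V b v1) : R) : 'rV[R]_n -> R) +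
     (t *: (fun y => w y (set_row V b v2) : R) : 'rV[R]_n -> R)) x)).
    apply: near_eq_derive; apply: filterS nA => y Ay.
    by have /alternating_formP[/(_ V b v1 v2 s t) wl _] := wa y Ay.
  apply: etrans (deriveD (derivableZ (k := s) (wd _)) (derivableZ (k := t) (wd _))) _.
  by congr (_ + _); exact: deriveZ.
move=> V i j ij Vij; apply: etrans (derive_cst (0 : R) x u).
apply: near_eq_derive; apply: filterS nA => y Ay.
by have /alternating_formP[_ wv] := wa y Ay; exact: wv ij Vij.
Qed.

Lemma dd_alternating k A (w : local_form k) x : open A -> form_on A w -> A x ->
  alternating_form (dd w x).
Proof.
move=> oA wf Ax; apply: asum_alternating => [u|u v s t W].
  exact: alternating_derive oA wf Ax.
by apply: deriveEl; exact: smooth_differentiable (wf.2 W) Ax.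
Qed.

(** The conditional inside the product mirrors [set_row], so that the terms of the product rule
    reassemble into a form with one row replaced. *)
Lemma derive_prod k (F : 'I_k -> 'rV[R]_n -> R) x u :
  (forall a, differentiable (F a) x) ->
  differentiable (fun y => \prod_a F a y : R) x /\
  'D_u (fun y => \prod_a F a y : R) x =
  \sum_b \prod_a (if a == b then 'D_u (F a) x else F a x).
Proof.
elim: k F => [|k IH] F Fd.
  have -> : (fun y => \prod_(a < 0) F a y) = cst 1 by apply/funext => y; rewrite big_ord0.
  by rewrite big_ord0 derive_cst; split=> //; exact: differentiable_cst.
have [Gd GE] := IH (fun a => F (lift ord0 a)) (fun a => Fd _).
have -> : (fun y => \prod_a F a y) = F ord0 * (fun y => \prod_a F (lift ord0 a) y).
  by apply/funext => y; rewrite big_ord_recl.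
split; first exact: differentiableM.
apply: etrans (deriveM (diff_derivable (Fd _)) (diff_derivable Gd)) _.
rewrite big_ord_recl big_ord_recl eqxx [LHS]addrC; congr (_ + _).
  apply: etrans (mulrC _ _) _; congr (_ * _); apply: eq_bigr => a _.
rewrite GE -[LHS]/(_ * _) mulr_sumr; apply: eq_bigr => b _.
by rewrite big_ord_recl.
Qed.

Lemma addD_eq (a b a' b' : R) : a = a' -> b = b' -> a + b = a' + b'.
Proof. by move=> -> ->. Qed.

Lemma mulD_eq (a d w e d' s : R) : d = d' -> e * w = s -> a * d + w * e = a * d' + s.
Proof. by move=> -> <-; rewrite [w * e]mulrC. Qed.

Definition hess p x (u v : 'rV[R]_n) : 'rV[R]_n :=
  \row_l 'D_u ('D_v (fun y => p y 0 l : R)) x.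

(** In components, differentiating the coefficients of [w] gives the first term by the chain rule;
    differentiating each row of the pushed-forward tuple gives the Hessian terms. *)
Lemma derive_pb k A B p (w : local_form k) x u W : open A -> open B -> smooth_on A p ->
  (forall x, A x -> B (p x)) -> form_on B w -> A x ->
  'D_u (fun y => pb p w y W : R) x =
  'D_(u *m jacobian p x) (fun z => w z (W *m jacobian p x) : R) (p x) +
  \sum_b w (p x) (set_row (W *m jacobian p x) b (hess p x u (row b W))).
Proof.
move=> oA oB ps pB [wa ws] Ax; have nA := open_nbhs_nbhs (conj oA Ax).
have nB := open_nbhs_nbhs (conj oB (pB x Ax)).
have pd y : A y -> differentiable p y by exact: smooth_differentiable.
set N := fun y => W *m jacobian p y.
have NE a l y : A y -> N y a l = 'D_(row a W) (fun y => p y 0 l : R) y.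
  move=> Ay; apply: etrans (esym (derive_coord _ _ (pd y Ay))).
  by rewrite (deriveEjacobian _ (pd y Ay)) -row_mul [RHS]mxE.
have Ns a l : smooth_on A (fun y => N y a l : R).
  by apply: smooth_mulmx => // i j; [exact: smooth_cst|exact: smooth_jacobian].
have Nd a l : differentiable (fun y => N y a l : R) x := smooth_differentiable (Ns a l) Ax.
have ND a l : 'D_u (fun y => N y a l : R) x = hess p x u (row a W) 0 l.
  by rewrite mxE; apply: near_eq_derive; apply: filterS nA => y Ay; exact: NE.
have wLd L : differentiable (fun z => w z (basis_rows R L) : R) (p x).
  exact: smooth_differentiable (ws _) (pB x Ax).
have wLpd L : differentiable ((fun z => w z (basis_rows R L) : R) \o p) x.
  exact: differentiable_comp (pd x Ax) (wLd L).
pose F (L : {ffun 'I_k -> 'I_n}) : 'rV[R]_n -> R :=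
  (fun y => \prod_a N y a (L a) : R) * ((fun z => w z (basis_rows R L) : R) \o p).
have prd (L : {ffun 'I_k -> 'I_n}) := derive_prod u (fun a => Nd a (L a)).
have FD L : 'D_u (F L) x =
    (\prod_a N x a (L a)) * 'D_(u *m jacobian p x) (fun z => w z (basis_rows R L) : R) (p x) +
    \sum_b (\prod_a (set_row (N x) b (hess p x u (row b W))) a (L a)) * w (p x) (basis_rows R L).
  apply: etrans (deriveM (diff_derivable (prd L).1) (diff_derivable (wLpd L))) _.
  apply: (mulD_eq _ (derive_comp u (pd x Ax) (wLd L))).
  rewrite (prd L).2 mulr_suml; apply: eq_bigr => b _; congr (_ * _).
  apply: eq_bigr => a _; rewrite [in RHS]mxE.
  by have [->|//] := eqVneq a b; exact: ND.
have Fd L : differentiable (F L) x.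
  by apply: differentiableM; [exact: (prd L).1|exact: wLpd].
have expd : 'D_u (fun y => pb p w y W : R) x = \sum_L 'D_u (F L) x.
  apply: etrans (derive_big_sum _ u Fd).2.
  apply: near_eq_derive; apply: filterS nA => y Ay.
  have /alternating_formP[wl _] := wa (p y) (pB y Ay).
  exact: mlinear_expand (N y) wl.
apply: etrans expd _; apply: etrans (eq_bigr _ (fun L _ => FD L)) _.
apply: etrans (big_split _ _ _ _ _) _; apply: addD_eq.
- pose G (L : {ffun 'I_k -> 'I_n}) : 'rV[R]_n -> R :=
    (\prod_a N x a (L a)) *: (fun z => w z (basis_rows R L) : R).
  have Gd L : differentiable (G L) (p x) by exact: differentiableZ.
  apply: (@etrans _ _ (\sum_L 'D_(u *m jacobian p x) (G L) (p x))).
    by apply: eq_bigr => L _; apply/esym/deriveZ/diff_derivable.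
  apply: etrans (esym (derive_big_sum _ _ Gd).2) _.
  apply: near_eq_derive; apply: filterS nB => z Bz.
  have /alternating_formP[wl _] := wa z Bz.
  exact: esym (mlinear_expand (N x) wl).
- rewrite exchange_big; apply: eq_bigr => b _.
  have /alternating_formP[wl _] := wa (p x) (pB x Ax).
  by rewrite [RHS](mlinear_expand _ wl).
Qed.

Lemma hess_sym A p x u v : open A -> smooth_on A p -> A x -> hess p x u v = hess p x v u.
Proof.
move=> oA ps Ax; apply/rowP => l.
apply: etrans (mxE _ _ _ _) _; apply: etrans _ (esym (mxE _ _ _ _)).
exact: derive_sym oA (smooth_coord _ oA ps) Ax.
Qed.

Lemma dd_pb k A B p (w : local_form k) x : open A -> open B -> smooth_on A p ->
  (forall x, A x -> B (p x)) -> form_on B w -> A x -> dd (pb p w) x = pb p (dd w) x.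
Proof.
move=> oA oB ps pB wf Ax; apply/funext => V.
have pwf := form_on_pb oA oB ps pB wf.
set J := jacobian p x.
pose h1 u W := 'D_(u *m J) (fun z => w z (W *m J) : R) (p x).
pose T b (M : 'M[R]_(k.+1, n)) := w (p x) (set_row (row' ord0 M *m J) b
  (hess p x (row ord0 M) (row b (row' ord0 M)))).
have h1a u : alternating_form (h1 u).
  exact: alternating_comp (alternating_derive (u *m J) oB wf (pB x Ax)).
have -> : pb p (dd w) x V = asum h1 V.
  apply: eq_bigr => a _; congr (_ * _).
  by rewrite /h1 -row_mul (_ : row' a V *m J = row' a (V *m J)) //;
    apply/row_matrixP => b; rewrite row_mul !row_row' row_mul.
apply: (mulfI (natfact_neq0 R k)).
apply: etrans (asum_perm _ (fun u => alternating_derive u oA pwf Ax)) _.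
apply: etrans (eq_bigr _ (fun s _ => congr1 _
  (derive_pb (row ord0 (row_perm s V)) (row' ord0 (row_perm s V)) oA oB ps pB wf Ax))) _.
rewrite [RHS](asum_perm _ h1a).
apply: etrans (eq_bigr _ (fun s _ => mulrDr _ _ _)) _.
apply: etrans (big_split _ _ _ _ _) _.
rewrite [X in _ + X = _](_ : _ = 0) ?addr0//.
transitivity (\sum_b \sum_(s : 'S_k.+1) (-1) ^+ s * T b (row_perm s V)).
  by rewrite exchange_big; apply: eq_bigr => s _; rewrite mulr_sumr.
(* The transposition exchanges the differentiating vector with the [b]-th remaining one. The Hessian
   is symmetric in these two, and the other rows are untouched. *)
apply: big1 => b _; apply: (@tperm_sum0 _ _ _ _ ord0 (lift ord0 b)); first exact: neq_lift.
move=> s; rewrite row_permM /T; move: (row_perm s V) => M.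
set M' := row_perm _ M.
have r0 : row ord0 M' = row (lift ord0 b) M.
  by apply/rowP => j; rewrite !mxE tpermL.
have rb : row b (row' ord0 M') = row ord0 M.
  by apply/rowP => j; rewrite !mxE tpermR.
rewrite r0 rb row_row' (hess_sym _ _ oA ps Ax); congr (w _ _).
apply/row_matrixP => a; rewrite !row_set_row; case: eqVneq => // ab.
rewrite !row_mul; congr (_ *m _); apply/rowP => j; rewrite !mxE tpermD//.
by rewrite (inj_eq (@lift_inj _ _)) eq_sym.
Qed.

Lemma alternating_cons k (f : 'M[R]_(k.+1, n) -> R) (V : 'M[R]_(k.+1, n)) (a : 'I_k.+1) :
  alternating_form f ->
  f (cons_row (row a V) (row' a V)) = (-1) ^+ a * f V.
Proof.
move=> fa; have <- : row_perm (lift_perm ord0 a 1%g) V = cons_row (row a V) (row' a V).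
  apply: eq_cons_row; first by apply/rowP => j; rewrite !mxE lift_perm_id.
  by apply/matrixP => i j; rewrite !mxE lift_perm_lift perm1.
rewrite alternating_row_perm// odd_lift_perm odd_perm1 addbF /=.
by rewrite signr_odd.
Qed.
End LocalForms.

(** * The homotopy operator *)

Section Poincare.
Context (R : realType) (n : nat) (A : set 'rV[R]_n) (c : 'rV[R]_n).
Hypothesis oA : open A.
Hypothesis starA : forall x, A x -> exists2 K, compact K & K `<=` A /\
  \forall y \near x, forall t : R, 0 <= t <= 1 -> K (c + t *: (y - c)).

(* The Poincare homotopy operator: int_0^1 t^k w(c + t (x - c))(x - c, V) dt,
   with the constant factor (x - c)_j taken out of the integral. *)
Definition homotopy k (w : local_form R n k.+1) : local_form R n k := fun x V =>
  \sum_j (x - c) 0 j * ray_int c k (fun y => w y (cons_row (delta_mx 0 j) V) : R) x.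

Lemma ray_int_lin m (f g1 g2 : 'rV[R]_n -> R) (s t : R) x :
  smooth_on A g1 -> smooth_on A g2 -> A x ->
  (forall y, A y -> f y = s * g1 y + t * g2 y) ->
  ray_int c m f x = s * ray_int c m g1 x + t * ray_int c m g2 x.
Proof.
move=> g1s g2s Ax fE.
have := @ray_int_sum R n A c starA bool [:: true; false] (fun b => if b then s else t)
  (fun b => if b then g1 else g2) f m x.
rewrite !big_cons !big_nil addr0 => -> // [] // y Ay.
by rewrite !big_cons big_nil addr0 fE.
Qed.

Lemma homotopy_form k (w : local_form R n k.+1) : form_on A w -> form_on A (homotopy w).
Proof.
move=> [wa ws]; split=> [x Ax|V]; last first.
  apply: smooth_sum => // j; apply: smoothM => //.
    have xjs : smooth_on A (fun x : 'rV[R]_n => x 0 j + - c 0 j : R).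
      apply: smoothD => //; last exact: smooth_cst.
      by apply: smooth_coord => //; exact: smooth_id.
    by apply: smooth_eq xjs => // x _; rewrite !mxE.
  exact: smooth_ray_int.
apply: alternating_sum => j; apply: alternating_scale; apply/alternating_formP; split.
  move=> V b u v s t; apply: ray_int_lin => // y /wa/alternating_formP[wl _].
  exact: (mlinear_cons (delta_mx 0 j) wl).
move=> V a b ab Vab.
(* A combination over the empty list expresses that the integral vanishes when the integrand does so
   on [A]. *)
rewrite (@ray_int_sum _ _ _ _ starA bool [::] (fun=> 0) (fun=> cst 0)) ?big_nil// => [_|y Ay].
  exact: smooth_cst.
rewrite big_nil; have /alternating_formP[_ wv] := wa y Ay.
apply: (wv _ (lift ord0 a) (lift ord0 b)); first by rewrite (inj_eq (@lift_inj _ _)).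
by rewrite !row_consS.
Qed.

(** The derivative of the homotopy splits into the contribution of the factor (x - c)_j and that of
    the integral. Closedness rewrites the second so that the total is the radial identity
    [ray_int_euler] applied to the coefficient of [w] on [V]. *)
Lemma poincare_star k (w : local_form R n k.+1) : form_on A w ->
  (forall x, A x -> dd w x = fun=> 0) -> forall x, A x -> dd (homotopy w) x = w x.
Proof.
move=> wf dw x Ax; have [wa ws] := wf; apply/funext => V.
pose f j (W : 'M[R]_(k, n)) : 'rV[R]_n -> R := fun y => w y (cons_row (delta_mx 0 j) W).
pose I := ray_int c k; pose I' := ray_int c k.+1.
have fs j W : smooth_on A (f j W) by exact: ws.
have dh u W : 'D_u (fun y => homotopy w y W : R) x =
    I (fun y => w y (cons_row u W)) x + \sum_j (x - c) 0 j * I' ('D_u (f j W)) x.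
  pose X j : 'rV[R]_n -> R := fun y => (y - c) 0 j.
  have Xd j : differentiable (X j) x.
    apply: differentiable_coordf; apply: differentiableB; last exact: differentiable_cst.
    exact: (ex_diff (df := id)).
  have XD j : 'D_u (X j) x = u 0 j.
    apply: etrans (derive_coord _ _ _) _.
      apply: differentiableB; last exact: differentiable_cst.
      exact: (ex_diff (df := id)).
    have -> : 'D_u (fun y : 'rV[R]_n => y - c) x = 'D_u (id : 'rV[R]_n -> 'rV[R]_n) x - 'D_u (cst c) x.
      by apply: deriveB; [exact: derivable_id|exact: derivable_cst].
    by rewrite derive_id derive_cst subr0.
  have Id j : differentiable (I (f j W)) x by apply: (ray_int_differentiable oA starA k _ Ax).1.
  have IE : I (fun y => w y (cons_row u W)) x = \sum_j u 0 j * I (f j W) x.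
    apply: (ray_int_sum starA) => // y Ay.
    have /alternating_formP[wl _] := wa y Ay.
    by rewrite -(mlinear_cons_sum _ _ _ wl) -row_sum_delta.
  apply: etrans (derive_big_sum _ u (fun j => differentiableM (Xd j) (Id j))).2 _.
  rewrite IE -big_split; apply: eq_bigr => j _.
  apply: etrans (deriveM (diff_derivable (Xd j)) (diff_derivable (Id j))) _.
  rewrite addrC; apply: addD_eq; first by rewrite XD -[LHS]/(_ * _) mulrC.
  by congr (_ * _); exact: (ray_int_derive oA starA).
have wVs : smooth_on A (fun y => w y V : R) by exact: ws.
apply: etrans (eq_bigr _ (fun a _ => congr1 _ (dh (row a V) (row' a V)))) _.
apply: etrans (eq_bigr _ (fun a _ => mulrDr _ _ _)) _.
apply: etrans (big_split _ _ _ _ _) _.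
(* Each of the k + 1 terms of the first kind moves row [a] back into its place; the resulting sign
   cancels (-1)^a, which yields the factor k + 1. *)
apply: etrans _ (ray_int_euler starA k wVs Ax); apply: addD_eq.
  rewrite (eq_bigr (fun=> I (fun y => w y V) x)) ?sumr_const ?card_ord ?mulr_natl// => a _.
  rewrite /I (@ray_int_lin k _ (fun y => w y V) (cst 0) ((-1) ^+ a) 0 x) //.
  - by rewrite mul0r addr0 signrMK.
  - exact: smooth_cst.
  - by move=> y Ay; rewrite mul0r addr0; exact: alternating_cons (wa y Ay).
apply: (@etrans _ _ (\sum_j (x - c) 0 j * I' ('D_(delta_mx 0 j) (fun y => w y V : R)) x)).
  under eq_bigr do rewrite mulr_sumr.
  rewrite exchange_big; apply: eq_bigr => j _.
  under eq_bigr do rewrite mulrCA.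
  rewrite -mulr_sumr; congr (_ * _); apply/esym.
  apply: (ray_int_sum starA) => // [a|y Ay]; first exact: smooth_derive.
  (* Closedness on e_j followed by the rows of [V]: the derivative along e_j equals the alternating
     sum of the derivatives along the rows of [V]. *)
  have := congr1 (fun F => F (cons_row (delta_mx 0 j) V)) (dw y Ay).
  rewrite /dd /asum big_ord_recl row_cons0 row'_cons0 expr0 mul1r => /eqP.
  rewrite addr_eq0 => /eqP E; apply: etrans E _; rewrite -sumrN.
  apply: eq_bigr => a _; rewrite row_consS row'_lift_cons.
  by rewrite exprS mulN1r mulNr opprK.
apply/esym/(ray_int_sum starA) => // [j|y Ay]; first exact: smooth_derive.
exact: (derive_delta _ (smooth_differentiable wVs Ay)).
Qed.
End Poincare.

(** * Round balls in the sup norm topology *)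

Section EuclideanBall.
Context (R : realType) (n : nat) (c : 'rV[R]_n).

Let dist2 (x : 'rV[R]_n) : R := \sum_j (x 0 j - c 0 j) ^+ 2.

Lemma dist2_continuous : continuous dist2.
Proof.
move=> x; have oT : open [set: 'rV[R]_n] := openT.
have s : smooth_on setT (fun x : 'rV[R]_n => \sum_j (x 0 j - c 0 j) * (x 0 j - c 0 j) : R).
  apply: smooth_sum => // j; apply: smoothM => //;
    (apply: smoothD => //; last exact: smooth_cst);
    by apply: smooth_coord => //; exact: smooth_id.
have -> : dist2 = (fun x : 'rV[R]_n => \sum_j (x 0 j - c 0 j) * (x 0 j - c 0 j)).
  by apply/funext => y; apply: eq_bigr => j _; rewrite expr2.
exact: smooth_continuous s _.
Qed.

Lemma open_euclidean_ball r : open (euclidean_ball c r).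
Proof.
rewrite openE => x xr.
have H := cvgr_lt _ (@dist2_continuous x) _ xr; exact: H.
Qed.

Lemma compact_dist2_le s : compact [set x | dist2 x <= s].
Proof.
apply: bounded_closed_compact.
  exists (`|c| + (1 + `|s|)); split; first exact: num_real.
  move=> M cM x /= xs; apply: le_trans (ltW cM).
  rewrite -[x in `|x|](subrK c) addrC (le_trans (ler_normD _ _))// lerD2l.
  rewrite [leLHS]/Num.Def.normr/= mx_normrE bigmax_le ?addr_ge0// => -[i j] _ /=.
  (* Each coordinate difference [a] satisfies |a| <= 1 + a^2, and a^2 is one term of the squared
     distance. *)
  rewrite ord1 !mxE; apply: (@le_trans _ _ (1 + (x 0 j - c 0 j) ^+ 2)).
    rewrite -real_normK ?num_real//; set a := `|_|.
    have := sqr_ge0 (a - 1); nra.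
  rewrite lerD2l; apply: le_trans (ler_norm s); apply: le_trans xs.
  by rewrite /dist2 (bigD1 j)//= lerDl sumr_ge0// => l _; exact: sqr_ge0.
have -> : [set x | dist2 x <= s] = dist2 @^-1` [set y | y <= s] by [].
by apply: closed_comp => [x _|]; [exact: dist2_continuous|exact: closed_le].
Qed.

Lemma euclidean_ball_star r x : euclidean_ball c r x ->
  exists2 K, compact K & K `<=` euclidean_ball c r /\
  \forall y \near x, forall t : R, 0 <= t <= 1 -> K (c + t *: (y - c)).
Proof.
rewrite /euclidean_ball /= -/(dist2 x) => xr.
(* With [s] midway between the squared distance of [x] and r^2, the closed ball of squared radius
   [s] is compact inside the open ball, and points near [x] remain in it. *)
have := midf_lt xr; set s := (_ / _) => -[xs sr].
exists [set x | dist2 x <= s]; first exact: compact_dist2_le.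
split=> [y ys|]; first exact: le_lt_trans ys sr.
have H := cvgr_lt _ (@dist2_continuous x) _ xs.
have {}H : nbhs x [set y | dist2 y < s] by exact: H.
move: H; apply: filterS => y /= ys t /andP[t0 t1].
apply: le_trans (ltW ys); apply: ler_sum => j _.
rewrite !mxE addrAC subrr add0r exprMn ler_piMl ?sqr_ge0//.
by rewrite expr_le1.
Qed.
End EuclideanBall.

Section PullbackMore.
Context (R : realType) (n : nat).

Lemma pb_near k p q (w : local_form R n k) x : differentiable p x ->
  {near x, p =1 q} -> pb p w x = pb q w x.
Proof.
move=> pd pq; apply/funext => V; rewrite /pb (jacobian_near pd pq).
by rewrite (nbhs_singleton pq).
Qed.

Lemma pb_id k (w : local_form R n k) x : pb id w x = w x.
Proof. by apply/funext => V; rewrite /pb jacobian_id mulmx1. Qed.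

Lemma pb_eq k p (w1 w2 : local_form R n k) x : w1 (p x) = w2 (p x) ->
  pb p w1 x = pb p w2 x.
Proof. by move=> e; apply/funext => V; rewrite /pb e. Qed.

(** Being a smooth form is local; this serves for a form whose expression switches charts from point
    to point. *)
Lemma form_on_local k A (w : local_form R n k) :
  (forall x, A x -> exists D w', [/\ open D, D x, form_on D w' & forall z, D z -> w' z = w z]) ->
  form_on A w.
Proof.
move=> loc; split=> [x /loc[D [w' [_ Dx [w'a _] ww]]]|V]; first by rewrite -ww//; exact: w'a.
apply: smooth_pointwise => x /loc[D [w' [oD Dx [_ w's] ww]]].
have DS : smooth_on D (fun x => w x V : R).
  by apply: smooth_eq (w's V) => // z Dz; rewrite ww.
by apply: smooth_subset DS => _ ->.
Qed.
End PullbackMore.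

(** * The Poincare lemma on a star-shaped region *)

Section Region.
Context (R : realType) (n : nat) (M : manifold R n).
Implicit Types (i j : chart M) (U : set M).

Lemma chart_image_open i U : open U -> open (cmap i @` (cdom i `&` U)).
Proof.
move=> oU; rewrite openE => _ [p [ip Up] <-].
have ip' : (cmap i @` cdom i) (cmap i p) by exists p.
have N1 := open_nbhs_nbhs (conj (@open_cmap _ _ M i) ip').
have N2 : nbhs (cmap i p) (cinv i @^-1` U).
  apply: (cinv_continuous ip'); rewrite cmapK//.
  exact: open_nbhs_nbhs (conj oU Up).
apply: filterS2 N1 N2 => _ [q iq <-] /=; rewrite cmapK// => Uq.
by exists q.
Qed.

Lemma open_creg U i : open U -> open (creg U i).
Proof. exact: chart_image_open. Qed.

Lemma open_coverlap U i j : open U -> open (coverlap U i j).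
Proof.
move=> oU; rewrite /coverlap -setIA; apply: chart_image_open.
by apply: openI => //; exact: (@open_cdom _ _ M j).
Qed.

Lemma transition_differentiable U i j x : coverlap U i j x ->
  differentiable (transition i j) x.
Proof.
move=> [p [[ip jp] _] <-]; apply: smooth_differentiable (transition_smooth i j) _.
by exists p.
Qed.

Lemma diff_form_on k U (w : diff_form U k) i : form_on (creg U i) (form_val w i).
Proof. by split; [exact: form_alternating|exact: form_smooth]. Qed.

Lemma poincare_region U k (w : diff_form U k.+1) : star_shaped_region U ->
  (forall i x, creg U i x -> dd (form_val w i) x = fun=> 0) ->
  exists b : diff_form U k, forall i x, creg U i x -> dd (form_val b i) x = form_val w i x.
Proof.
move=> [oU [c [r [r0 [f [h [fh hf hc fs hs]]]]]]] dw.
set B := euclidean_ball c r in fh hf hc hs.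
have oB : open B := @open_euclidean_ball R n c r.
pose D i := [set y | B y /\ cdom i (h y)].
have oD i : open (D i).
  rewrite openE => y [By iy]; apply: filterI; first exact: open_nbhs_nbhs.
  by apply: (hc y By); exact: open_nbhs_nbhs (conj (@open_cdom _ _ M i) iy).
(* [psi i] reads the diffeomorphism from the ball in the chart [i], and [chi i] is its inverse on
   the chart region. *)
pose psi i := cmap i \o h.
pose chi i := f \o cinv i.
have psi_creg i y : D i y -> creg U i (psi i y).
  by move=> [By iy]; exists (h y) => //; split => //; exact: (hf y By).1.
have chi_D i x : creg U i x -> D i (chi i x) /\ psi i (chi i x) = x.
  move=> [p [ip Up] <-]; rewrite /psi /chi /= cmapK//.
  by have [Bf hfp] := fh p Up; rewrite /D /= hfp.
have chi_B i x : creg U i x -> B (chi i x) by move=> /chi_D[[]].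
have psid i y : D i y -> differentiable (psi i) y by apply: smooth_differentiable; exact: hs.
have chid i x : creg U i x -> differentiable (chi i) x by apply: smooth_differentiable; exact: fs.
have nD i y : D i y -> nbhs y (D i) by move=> Dy; exact: open_nbhs_nbhs.
have cover y : exists i, cdom i (h y) := cdom_cover (h y).
pose idx y := projT1 (cid (cover y)).
have idxP y : cdom (idx y) (h y) := projT2 (cid (cover y)).
(* The chart is chosen separately at every point. [OmE] removes the dependence on the choice, so
   near each point [Om] is the pullback from one fixed chart, hence smooth and closed. *)
pose Om : local_form R n k.+1 := fun y => pb (psi (idx y)) (form_val w (idx y)) y.
have OmE i y : D i y -> pb (psi i) (form_val w i) y = Om y.
  move=> Dy; have [By iy] := Dy; rewrite /Om; set j := idx y.
  have Djy : D j y by split => //; exact: idxP.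
  have ov : coverlap U j i (psi j y).
    by exists (h y) => //; split; [split => //; exact: idxP|exact: (hf y By).1].
  have td := transition_differentiable ov.
  have E : {near y, transition j i \o psi j =1 psi i}.
    apply: filterS (nD j y Djy) => z [Bz jz].
    by rewrite /transition /psi /= cmapK.
  have cd : differentiable (transition j i \o psi j) y.
    by apply: differentiable_comp => //; exact: psid.
  apply: etrans (esym (pb_near _ cd E)) _.
  apply: etrans (esym (pb_comp _ (psid j y Djy) td)) _.
  by apply: pb_eq; apply/funext => V; exact: esym (@form_compat _ _ _ _ _ w j i _ ov V).
have Omf : form_on B Om.
  apply: form_on_local => y By; exists (D (idx y)), (pb (psi (idx y)) (form_val w (idx y))).
  split; [exact: oD|exact: conj By (idxP y)| |by move=> z; exact: OmE].
  exact: form_on_pb (oD _) (open_creg oU) (hs _) (psi_creg _) (diff_form_on w _).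
have dOm y : B y -> dd Om y = fun=> 0.
  move=> By; have Dy : D (idx y) y by split.
  have E : {near y, Om =1 pb (psi (idx y)) (form_val w (idx y))}.
    by apply: filterS (nD _ y Dy) => z Dz; rewrite OmE.
  apply: etrans (dd_near E) _.
  apply: etrans (dd_pb (oD _) (open_creg oU) (hs _) (psi_creg _) (diff_form_on w _) Dy) _.
  exact: (@pb_eq _ _ _ (psi (idx y)) _ (fun _ _ => 0) y (dw _ _ (psi_creg _ _ Dy))).
have stB := @euclidean_ball_star R n c r.
pose al := homotopy c Om.
have alf : form_on B al := homotopy_form oB stB Omf.
pose b i := pb (chi i) al.
have bf i : form_on (creg U i) (b i).
  exact: form_on_pb (open_creg oU : open (creg U i)) oB (fs i) (chi_B i) alf.
have b_compat i j x : coverlap U i j x -> forall V : 'M[R]_(k, n),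
    b i x V = b j (transition i j x) (V *m jacobian (transition i j) x).
  move=> ov V; have td := transition_differentiable ov.
  rewrite -[RHS]/(pb (transition i j) (b j) x V).
  have [p [[ip jp] Up] pE] := ov.
  have cx : creg U i x by exists p.
  have cjx : creg U j (transition i j x).
    by exists p => //; rewrite /transition /= -pE cmapK.
  apply: etrans _ (congr1 (fun F => F V) (esym (pb_comp al td (chid j _ cjx)))).
  apply: (congr1 (fun F => F V)); apply: pb_near; first exact: chid.
  apply: filterS (open_nbhs_nbhs (conj (open_coverlap oU : open (coverlap U i j)) ov)) => _ [q [[iq jq] Uq] <-].
  by rewrite /chi /transition /= !cmapK.
exists (DiffForm (fun i x => (bf i).1 x) (fun i => (bf i).2) b_compat) => i x cx /=.
(* The derivative of the pulled back primitive is the pullback of [Om] by [chi i], that is of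
   [form_val w i] by [psi i \o chi i], a map equal to the identity near [x]. *)
apply: etrans (dd_pb (open_creg oU : open (creg U i)) oB (fs i) (chi_B i) alf cx) _.
have [Dx psichi] := chi_D i x cx.
have E1 := poincare_star oB stB Omf dOm (chi_B i x cx).
apply: etrans (pb_eq (etrans E1 (esym (OmE i _ Dx)))) _.
apply: etrans (pb_comp _ (chid i x cx) (psid i _ Dx)) _.
have cd : differentiable (psi i \o chi i) x.
  by apply: differentiable_comp; [exact: chid|exact: psid].
have nid : {near x, psi i \o chi i =1 id}.
  apply: filterS (open_nbhs_nbhs (conj (open_creg oU : open (creg U i)) cx)) => z cz.
  exact: (chi_D i z cz).2.
have Q1 := pb_near (form_val w i) cd nid.
have Q2 := pb_id (form_val w i) x.
exact: etrans Q1 Q2.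
Qed.
End Region.

(** * Coclosed forms *)

Section StarForms.
Context (R : realType) (n : nat) (M : manifold R n) (U : set M).
Hypothesis oU : open U.
Context (g : riemannian_metric U) (o : orientation U).

Lemma gram_is_posdef i x : creg U i x -> posdef (g i x).
Proof. by move=> cx; split; [exact: gram_sym|exact: gram_posdef]. Qed.

(** A continuous function with values 1 and -1 is locally constant: two nearby values differ by less
    than 1. *)
Lemma smooth_osign i : smooth_on (creg U i) (fun x => o i x : R).
Proof.
have oc : open (creg U i) := open_creg oU.
apply: smooth_locally_const => // x cx.
have /(cvgr_distC_lt _) /(_ _ ltr01) N1 := osign_continuous cx (o := o).
apply: filterS2 N1 (open_nbhs_nbhs (conj oc cx)) => y + cy.
case: (osign_val o cx) => ->; case: (osign_val o cy) => -> //;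
  by rewrite ltr_norml => /andP[h1 h2]; exfalso; lra.
Qed.

Lemma star_alternating r s (rsn : (r + s)%N = n) (w : diff_form U r) i x :
  alternating_form (@star R n M U g o r s w i x).
Proof. exact: hodge_alternating. Qed.

Lemma smooth_star r s (rsn : (r + s)%N = n) (w : diff_form U r) i (V : 'M[R]_(s, n)) :
  smooth_on (creg U i) (fun x => @star R n M U g o r s w i x V : R).
Proof.
have oc : open (creg U i) := open_creg oU.
have gs a b : smooth_on (creg U i) (fun x => g i x a b : R) by exact: gram_smooth.
have gd x : creg U i x -> posdef (g i x) by exact: gram_is_posdef.
have S : smooth_on (creg U i) (fun x => (r`!%:R)^-1 * \sum_(I : {ffun 'I_r -> 'I_n})
    form_val w i x (basis_rows R I *m invmx (g i x)) *
    (o i x * Num.sqrt (\det (g i x)) * vdet (basis_rows R I) V) : R).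
  apply: smoothM => //; first exact: smooth_cst.
  apply: smooth_sum => // I; apply: smoothM => //.
    apply: (smooth_eval (N := fun x => basis_rows R I *m invmx (g i x)) oc (diff_form_on w i)).
    apply: smooth_mulmx => // a b; first exact: smooth_cst.
    by apply: smooth_invmx => // x /gd; exact: posdef_unit.
  apply: smoothM => //; last exact: smooth_cst.
  apply: smoothM => //; first exact: smooth_osign.
  apply: smooth_sqrt => //; first exact: smooth_det.
  by move=> x /gd; exact: posdef_det_gt0.
apply: smooth_eq S => // x _; apply/esym; exact: hodgeE.
Qed.

Lemma star_compat r s (rsn : (r + s)%N = n) (w : diff_form U r) i j x :
  coverlap U i j x -> forall V : 'M[R]_(s, n),
  @star R n M U g o r s w i x V =
  @star R n M U g o r s w j (transition i j x) (V *m jacobian (transition i j) x).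
Proof.
move=> ov V.
have [p [[ip jp] Up] pE] := ov.
have cx : creg U i x by exists p.
have cjx : creg U j (transition i j x).
  by exists p => //; rewrite /transition /= -pE cmapK.
apply: (hodge_natural rsn (gram_is_posdef cx) (gram_compat g ov) (osign_compat o ov)).
  exact: form_alternating.
by move=> W; exact: (@form_compat _ _ _ _ _ w i j x ov W).
Qed.

Definition star_form r s (rsn : (r + s)%N = n) (w : diff_form U r) : diff_form U s :=
  @DiffForm R n M U s (@star R n M U g o r s w)
    (fun i x _ => star_alternating rsn w i x) (smooth_star rsn w)
    (fun i j x ov => star_compat rsn w ov).

Lemma scale_alternating (c : R) r (w : diff_form U r) i x : creg U i x ->
  alternating_form (fun V => c * form_val w i x V).
Proof. by move=> cx; apply/alternating_scale/form_alternating. Qed.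

Lemma smooth_scale (c : R) r (w : diff_form U r) i (V : 'M[R]_(r, n)) :
  smooth_on (creg U i) (fun x => c * form_val w i x V : R).
Proof.
have oc : open (creg U i) := open_creg oU.
by apply: smoothM => //; [exact: smooth_cst|exact: form_smooth].
Qed.

Lemma scale_compat (c : R) r (w : diff_form U r) i j x : coverlap U i j x ->
  forall V : 'M[R]_(r, n), c * form_val w i x V =
  c * form_val w j (transition i j x) (V *m jacobian (transition i j) x).
Proof. by move=> ov V; congr (_ * _); exact: (@form_compat _ _ _ _ _ w i j x ov V). Qed.

Definition scale_form (c : R) r (w : diff_form U r) : diff_form U r :=
  @DiffForm R n M U r (fun i x V => c * form_val w i x V)
    (scale_alternating c w) (smooth_scale c w) (fun i j x ov => scale_compat c w ov).

Lemma dd_scale (c : R) k (w : diff_form U k) i x V : creg U i x ->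
  dd (form_val (scale_form c w) i) x V = c * dd (form_val w i) x V.
Proof.
move=> cx; rewrite /dd /asum mulr_sumr; apply: eq_bigr => a _.
apply: etrans _ (mulrCA _ _ _); congr (_ * _); apply: deriveZ.
exact: diff_derivable (smooth_differentiable (form_smooth w i _) cx).
Qed.

Lemma closed_star k s (ksn : (k + s)%N = n) (w : diff_form U k) :
  form_eq U (codiff g o w) (form_zero M k.-1) ->
  forall i x, creg U i x -> dd (form_val (star_form ksn w) i) x = fun=> 0.
Proof.
move=> hw i x cx; have oc : open (creg U i) := open_creg oU.
have da (v : diff_form U s) : alternating_form (dd (form_val v i) x).
  exact: dd_alternating oc (diff_form_on v i) cx.
case: k ksn w hw => [|k] ksn w hw.
  (* For k = 0 the hypothesis only states that 0 = 0; here [s] is [n], and the degree n + 1 exceeds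
     the dimension. *)
  by apply/funext => V; apply: alternating_gt_dim; [exact: da|rewrite -ksn add0n].
have sE : s = (n - k.+1)%N by rewrite -ksn addnC addnK.
subst s; have hwx := hw i x cx.
(* [codiff] applies the grading before the star, so the hypothesis concerns the star of the signed
   form; the sign is taken out of the star and of d afterwards. *)
pose v := star_form ksn (scale_form ((-1) ^+ k.+1) w).
have krs : (k + (n - k.+1).+1)%N = n by rewrite addnS -addSn.
have v0 : dd (form_val v i) x = fun=> 0.
  exact: (hodge_inv_eq0 krs (gram_is_posdef cx) (osign_val o cx) (da v) hwx).
have vE : {near x, form_val v i =1 form_val (scale_form ((-1) ^+ k.+1) (star_form ksn w)) i}.
  apply: filterS (open_nbhs_nbhs (conj oc cx)) => y _; apply/funext => V.
  exact: hodgeZ.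
apply/funext => V; have := dd_scale ((-1) ^+ k.+1) (star_form ksn w) V cx.
rewrite -(dd_near vE) v0 => /esym/eqP; rewrite mulf_eq0 signr_eq0 /=.
by move/eqP.
Qed.
End StarForms.

Theorem theorem1 (R : realType) (n : nat) (M : manifold R n) (U : set M)
    (hU : star_shaped_region U)
    (g : riemannian_metric U) (o : orientation U)
    (k : nat) (hk : (k < n)%N)
    (w : diff_form U k)
    (hw : form_eq U (codiff g o w) (form_zero M k.-1)) :
  exists a : diff_form U k.+1, form_eq U w (codiff g o a).
Proof.
have oU : open U := hU.1.
(* The degree n - k of the star of [w] is written as a successor, possible as k < n; this is the
   positive degree that the Poincare lemma asks for. *)
have ksn : (k + (n - k.+1).+1)%N = n by rewrite addnS -addSn subnKC.
have msn : (n - k.+1 + k.+1)%N = n by rewrite subnK.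
have smn : (k.+1 + (n - k.+1))%N = n by rewrite subnKC.
have [b bE] := poincare_region hU (closed_star oU ksn hw).
have [e e0 hh] := hodgeK R msn.
(* The inverse of the product of the two constants that arise in star eta a, with a = c star b: the
   grading sign in degree k + 1 and the double star constant. *)
pose c := ((-1) ^+ k.+1 * e)^-1.
exists (scale_form oU c (star_form oU g o msn b)) => i x cx.
have oc : open (creg U i) := open_creg oU.
(* Equality near [x], and not just at [x], because d is applied to it next. *)
have near_b : {near x, (fun y => hodge (g i y) (o i y)
    (fun V => (-1) ^+ k.+1 * (c * @hodge R n (g i y) (o i y) _ k.+1 (form_val b i y) V)))
    =1 form_val b i}.
  apply: filterS (open_nbhs_nbhs (conj oc cx)) => y cy; apply/funext => V.
  apply: etrans (hodgeZ _ _ _ _ _) _.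
  apply: etrans (congr1 _ (hodgeZ _ _ _ _ _)) _.
  apply: etrans (congr1 _ (congr1 _ (hh _ _ _ (gram_is_posdef g cy) (osign_val o cy)
    (form_alternating b cy) V))) _.
  have c0 : (-1) ^+ k.+1 * e != 0 by rewrite mulf_neq0// signr_eq0.
  have cE : c * ((-1) ^+ k.+1 * e) = 1 by rewrite mulVf.
  by move: (form_val b i y V) => z /=; rewrite mulrCA [_ * (e * z)]mulrA mulrA cE mul1r.
have dE := etrans (dd_near near_b) (bE i x cx).
(* The inverse star in [codiff] now meets d b, the star of [w], and returns [w] itself. *)
have key : hodge_inv (g i x) (o i x) (@hodge R n (g i x) (o i x) k (n - k.+1).+1 (form_val w i x))
    = form_val w i x.
  have Q := hodge_inv_hodge ksn (gram_is_posdef g cx) (osign_val o cx) (form_alternating w cx).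
  exact: Q.
exact: etrans (esym key) (congr1 (@hodge_inv R n (g i x) (o i x) k _) (esym dE)).
Qed.
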